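(* Let $n\ge1$, $\delta>0$ and $\beta=n$. Let $\mathbf f\in\mathcal H^{s_1}(\mathbf T^n)$ and $\mathbf g\in\mathcal H^{s_2}(\mathbf T^n)$ with $s_1>n$ and $s_2>n$, and let $$\mathbf u(x,t)=(\widehat{\mathbf f}_0+\widehat{\mathbf g}_0t)+\sum_{0\ne k\in\mathbb{Z}^n}\left(\cos(\sqrt{-M_k}\,t)\widehat{\mathbf f}_k+\sin(\sqrt{-M_k}\,t)(\sqrt{-M_k})^{-1}\widehat{\mathbf g}_k\right)e^{ik\cdot x}$$ for $x\in\mathbf T^n$, $t\ge0$. Then $\mathbf u(x,\cdot)\in C^\infty[0,\infty)$ (in the classical sense) for any $x\in\mathbf T^n$.
   Context: Torus and spaces: $\mathbf T^n=\prod_{i=1}^n[0,2\pi]$ with periodic identification; a periodic vector distribution $\mathbf g$ is written $\mathbf g=\sum_{k\in\mathbb{Z}^n}\widehat{\mathbf g}_k e^{ik\cdot x}$ with Fourier coefficients $\widehat{\mathbf g}_k\in\mathbb{C}^n$. For $q\in\mathbb{R}$, $\mathcal H^q(\mathbf T^n)$ is the space of periodic vector distributions with $\|\mathbf g\|^2_{\mathcal H^q}=\sum_k(1+\|k\|^2)^q\|\widehat{\mathbf g}_k\|^2<\infty$. Multipliers: with ${}_pF_q(a_1,\dots,a_p;b_1,\dots,b_q;x)=\sum_{m\ge0}\frac{(a_1)_m\cdots(a_p)_m}{(b_1)_m\cdots(b_q)_m}\frac{x^m}{m!}$, where $(a)_m=a(a+1)\cdots(a+m-1)$, set for $\nu\in\mathbb{R}^n$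 $$\lambda_1(\nu)=-\|\nu\|^2\Big(3\mu\,{}_3F_4\big(1,\tfrac52,\tfrac{n+2-\beta}{2};2,\tfrac32,\tfrac{n+4}{2},\tfrac{n+4-\beta}{2};-\tfrac14\|\nu\|^2\delta^2\big)+(\lambda^*-\mu)\,{}_1F_2\big(\tfrac{n+2-\beta}{2};\tfrac{n+2}{2},\tfrac{n+4-\beta}{2};-\tfrac14\|\nu\|^2\delta^2\big)^2\Big),$$ $$\lambda_2(\nu)=-\mu\|\nu\|^2\,{}_2F_3\big(1,\tfrac{n+2-\beta}{2};2,\tfrac{n+4}{2},\tfrac{n+4-\beta}{2};-\tfrac14\|\nu\|^2\delta^2\big).$$ For $k\in\mathbb{Z}^n\setminus\{0\}$, $M_k$ is the real symmetric $n\times n$ matrix with $M_kk=\lambda_1(k)k$ and $M_kw=\lambda_2(k)w$ for $w\perp k$ (the Fourier multiplier of the linear state-based peridynamic operator). $\sqrt{-M_k}$, $\cos(\sqrt{-M_k}t)$, $\sin(\sqrt{-M_k}t)$ are defined by functional calculus: same eigenvectors, with eigenvalues $\sqrt{-\lambda_i(k)}$, $\cos(\sqrt{-\lambda_i(k)}t)$, $\sin(\sqrt{-\lambda_i(k)}t)$. Standing assumption: the Lamé parameters satisfy $\mu>0$ and $\lambda^*\in\mathbb{R}$ is such that $\lambda_1(\nu)<0$ for all $\nu\ne0$ (and $\lambda_2(\nu)<0$ for all $\nu\neq0$). *)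

(* Defs.v *)
From mathcomp Require Import all_boot all_order all_algebra.
From mathcomp Require Import finmap all_classical all_reals all_analysis.
From mathcomp Require Import complex.
From mathcomp.analysis.showcase Require summability.
Set Implicit Arguments.
Unset Strict Implicit.
Unset Printing Implicit Defensive.
Import Order.TTheory GRing.Theory Num.Theory.
Import numFieldNormedType.Exports.
Local Open Scope classical_set_scope.
Local Open Scope ring_scope.
Local Open Scope complex_scope.

(* Vectors are columns. *)

Definition dot (R : pzRingType) (n : nat) (u v : 'cV[R]_n) : R :=
  \sum_(j < n) u j 0 * v j 0.

(* The square of the Euclidean norm; [`|u|] would be the sup norm of the
   library. *)
Definition sqnorm (R : realType) (n : nat) (u : 'cV[R]_n) : R := dot u u.

Definition csqnorm (R : realType) (n : nat) (z : 'cV[R[i]]_n) : R :=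
  \sum_(j < n) Normc.normc (z j 0) ^+ 2.

Definition freq (R : realType) (n : nat) (k : 'cV[int]_n) : 'cV[R]_n :=
  map_mx intr k.

Definition expi (R : realType) (theta : R) : R[i] := cos theta +i* sin theta.

(* Points of the torus are represented in the cube [0, 2 pi]^n. *)
Definition torus (R : realType) (n : nat) (x : 'cV[R]_n) : Prop :=
  forall j, 0 <= x j 0 <= 2 * pi.

Definition iter_pderive (R : realType) (n : nat) (s : seq 'I_n)
    (phi : 'cV[R]_n -> R) : 'cV[R]_n -> R :=
  foldr (fun j psi x => 'D_(delta_mx j 0) psi x) phi s.

Definition smooth (R : realType) (n : nat) (phi : 'cV[R]_n -> R) : Prop :=
  forall (s : seq 'I_n) (x : 'cV[R]_n), differentiable (iter_pderive s phi) x.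

Definition test_function (R : realType) (n : nat)
    (phi : 'cV[R]_n -> R[i]) : Prop :=
  [/\ smooth (fun x => complex.Re (phi x)),
      smooth (fun x => complex.Im (phi x)) &
      forall x j, phi (x + (2 * pi) *: delta_mx j 0) = phi x].

(* C^n-valued distributions on the torus: linear functionals on the smooth
   2 pi-periodic functions, continuous for the C^N seminorms.  The values of
   [pd_app] outside of the test functions are irrelevant. *)
Record periodic_distribution (R : realType) (n : nat) := PeriodicDistribution {
  pd_app :> ('cV[R]_n -> R[i]) -> 'cV[R[i]]_n;
  pd_linear : forall (a : R[i]) (phi psi : 'cV[R]_n -> R[i]),
    test_function phi -> test_function psi ->
    pd_app (fun x => a * phi x + psi x) = a *: pd_app phi + pd_app psi;
  pd_continuous : exists (N : nat) (C : R),
    forall (phi : 'cV[R]_n -> R[i]) (B : R), test_function phi ->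
    (forall s x, (size s <= N)%N ->
       `|iter_pderive s (fun y => complex.Re (phi y)) x| <= B /\
       `|iter_pderive s (fun y => complex.Im (phi y)) x| <= B) ->
    forall j, Normc.normc (pd_app phi j 0) <= C * B }.

Definition fourier_coef (R : realType) (n : nat)
    (g : periodic_distribution R n) (k : 'cV[int]_n) : 'cV[R[i]]_n :=
  (((2 * pi) ^- n)%:C) *: g (fun x => expi (- dot (freq R k) x)).

(* [sobolev q g]: g belongs to the space H^q(T^n). *)
Definition sobolev (R : realType) (n : nat) (q : R)
    (g : periodic_distribution R n) : Prop :=
  (\esum_(k in [set: 'cV[int]_n])
     ((1 + sqnorm (freq R k)) `^ q * csqnorm (fourier_coef g k))%:E < +oo)%E.

Definition rising (R : realType) (a : R) (m : nat) : R :=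
  \prod_(i < m) (a + i%:R).

Definition hypergeometric (R : realType) (a b : seq R) (x : R) : R :=
  limn (series (fun m : nat =>
    (\prod_(c <- a) rising c m) / (\prod_(c <- b) rising c m)
      * (x ^+ m / (m`!)%:R))).

Definition lambda1 (R : realType) (n : nat) (delta beta mu lam : R)
    (nu : 'cV[R]_n) : R :=
  let z := - (1 / 4) * (sqnorm nu * delta ^+ 2) in
  - sqnorm nu *
    (3 * mu * hypergeometric
       [:: 1; 5 / 2; (n%:R + 2 - beta) / 2]
       [:: 2; 3 / 2; (n%:R + 4) / 2; (n%:R + 4 - beta) / 2] z
     + (lam - mu) * (hypergeometric
       [:: (n%:R + 2 - beta) / 2]
       [:: (n%:R + 2) / 2; (n%:R + 4 - beta) / 2] z) ^+ 2).

Definition lambda2 (R : realType) (n : nat) (delta beta mu : R)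
    (nu : 'cV[R]_n) : R :=
  let z := - (1 / 4) * (sqnorm nu * delta ^+ 2) in
  - mu * sqnorm nu * hypergeometric
    [:: 1; (n%:R + 2 - beta) / 2]
    [:: 2; (n%:R + 4) / 2; (n%:R + 4 - beta) / 2] z.

(* For v <> 0, the matrix acting as a on the line of v and as b on its
   orthogonal complement; [eigen_mxP] characterizes it. *)
Definition eigen_mx (R : realType) (n : nat) (v : 'cV[R]_n) (a b : R) :
    'M[R]_n :=
  let P := (sqnorm v)^-1 *: (v *m v^T) in a *: P + b *: (1%:M - P).

Lemma sqnorm_gt0 (R : realType) (n : nat) (v : 'cV[R]_n) :
  v != 0 -> 0 < sqnorm v.
Proof.
move=> v0; rewrite lt_def /sqnorm /dot sumr_ge0 ?andbT; last first.
  by move=> j _; rewrite -expr2 sqr_ge0.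
apply: contra v0; rewrite psumr_eq0; last first.
  by move=> j _; rewrite -expr2 sqr_ge0.
move/allP => v0; apply/eqP/matrixP => i j; rewrite ord1 mxE.
by have := v0 i (mem_index_enum _); rewrite -expr2 sqrf_eq0 => /eqP.
Qed.

Lemma mul_dot (R : realType) (n : nat) (v w : 'cV[R]_n) :
  v *m v^T *m w = dot v w *: v.
Proof.
rewrite -mulmxA [v^T *m w]mx11_scalar mul_mx_scalar; congr (_ *: _).
by rewrite mxE /dot; apply: eq_bigr => j _; rewrite mxE.
Qed.

Lemma eigen_mx_line (R : realType) (n : nat) (v : 'cV[R]_n) (a b : R) :
  v != 0 -> eigen_mx v a b *m v = a *: v.
Proof.
move=> /sqnorm_gt0 v0; rewrite /eigen_mx; set P := _ *: (v *m _).
have Pv : P *m v = v.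
  by rewrite -scalemxAl mul_dot scalerA mulVf ?scale1r// gt_eqF.
by rewrite mulmxDl -(scalemxAl a) -(scalemxAl b) mulmxBl mul1mx Pv subrr scaler0 addr0.
Qed.

Lemma eigen_mx_orth (R : realType) (n : nat) (v w : 'cV[R]_n) (a b : R) :
  dot v w = 0 -> eigen_mx v a b *m w = b *: w.
Proof.
move=> vw; rewrite /eigen_mx; set P := _ *: (v *m _).
have Pw : P *m w = 0 by rewrite -scalemxAl mul_dot vw scale0r scaler0.
by rewrite mulmxDl -(scalemxAl a) -(scalemxAl b) mulmxBl mul1mx Pw scaler0 subr0 add0r.
Qed.

Lemma eigen_mx_sym (R : realType) (n : nat) (v : 'cV[R]_n) (a b : R) :
  (eigen_mx v a b)^T = eigen_mx v a b.
Proof.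
apply/matrixP => i j; rewrite !mxE !big_ord1 !mxE eq_sym.
by rewrite (mulrC (v j 0)).
Qed.

Lemma dotDr (R : realType) (n : nat) (v x y : 'cV[R]_n) :
  dot v (x + y) = dot v x + dot v y.
Proof.
by rewrite /dot -big_split/=; apply: eq_bigr => j _; rewrite mxE mulrDr.
Qed.

Lemma dotZr (R : realType) (n : nat) (a : R) (v x : 'cV[R]_n) :
  dot v (a *: x) = a * dot v x.
Proof. by rewrite /dot mulr_sumr; apply: eq_bigr => j _; rewrite mxE mulrCA. Qed.

Lemma dot_split (R : realType) (n : nat) (v w : 'cV[R]_n) : v != 0 ->
  exists c u, dot v u = 0 /\ w = c *: v + u.
Proof.
move=> /sqnorm_gt0 v0; exists (dot v w / sqnorm v), (w - (dot v w / sqnorm v) *: v).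
split; last by rewrite addrC subrK.
rewrite {1}/dot; under eq_bigr do rewrite !mxE mulrBr mulrCA.
by rewrite sumrB -mulr_sumr -!/(dot _ _) divfK ?subrr// gt_eqF.
Qed.

Lemma eigen_mxP (R : realType) (n : nat) (v : 'cV[R]_n) (a b : R)
    (A : 'M[R]_n) : v != 0 ->
  A *m v = a *: v -> (forall w, dot v w = 0 -> A *m w = b *: w) ->
  A = eigen_mx v a b.
Proof.
move=> v0 Av Aw; suff E (w : 'cV[R]_n) : A *m w = eigen_mx v a b *m w.
  apply/matrixP => i j; have := E (delta_mx j 0).
  by move/matrixP/(_ i 0); rewrite -!colE !mxE.
have [c [u [vu ->]]] := dot_split w v0.
by rewrite !mulmxDr -!scalemxAr Av Aw// eigen_mx_line// eigen_mx_orth.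
Qed.

Definition multiplier_mx (R : realType) (n : nat) (delta beta mu lam : R)
    (k : 'cV[int]_n) : 'M[R]_n :=
  eigen_mx (freq R k) (lambda1 delta beta mu lam (freq R k))
    (lambda2 delta beta mu (freq R k)).

(* phi(M_k); see [multiplier_funP]. *)
Definition multiplier_fun (R : realType) (n : nat) (delta beta mu lam : R)
    (phi : R -> R) (k : 'cV[int]_n) : 'M[R]_n :=
  eigen_mx (freq R k) (phi (lambda1 delta beta mu lam (freq R k)))
    (phi (lambda2 delta beta mu (freq R k))).

Lemma multiplier_funP (R : realType) (n : nat) (delta beta mu lam : R)
    (phi : R -> R) (k : 'cV[int]_n) (a : R) (w : 'cV[R]_n) : k != 0 ->
  multiplier_mx delta beta mu lam k *m w = a *: w ->
  multiplier_fun delta beta mu lam phi k *m w = phi a *: w.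
Proof.
move=> k0; rewrite /multiplier_mx /multiplier_fun.
set v := freq R k; set l1 := lambda1 _ _ _ _ _; set l2 := lambda2 _ _ _ _.
have v0 : v != 0.
  apply: contra k0 => /eqP/matrixP E; apply/eqP/matrixP => i j.
  by have := E i j; rewrite !mxE => /eqP; rewrite intr_eq0 => /eqP.
have [c [u [vu ->]]] := dot_split w v0.
rewrite !mulmxDr -!scalemxAr !eigen_mx_line// !eigen_mx_orth// => H.
have E1 : c * l1 = c * a.
  have := congr1 (dot v) H; rewrite !(dotDr, dotZr) vu !mulr0 !addr0.
  rewrite (mulrA c l1) (mulrA a c) (mulrC a c).
  by move/mulIf; apply; rewrite gt_eqF// sqnorm_gt0.
have E2 : l2 *: u = a *: u.
  move: H; rewrite scalerDr [a *: (c *: v)]scalerA scalerA E1 [a * c]mulrC.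
  by move/addrI.
rewrite scalerDr !scalerA; congr (_ + _).
  have [->|c0] := eqVneq c 0; first by rewrite mul0r mulr0.
  by rewrite (mulfI c0 E1) mulrC.
have [->|u0] := eqVneq u 0; first by rewrite !scaler0.
suff -> : l2 = a by [].
apply/eqP; rewrite -subr_eq0; have /eqP := E2.
by rewrite -subr_eq0 -scalerBl scaler_eq0 (negPf u0) orbF.
Qed.

Definition sqrtN_mx (R : realType) (n : nat) (delta beta mu lam : R)
    (k : 'cV[int]_n) : 'M[R]_n :=
  multiplier_fun delta beta mu lam (fun l => Num.sqrt (- l)) k.

Definition cos_sqrtN_mx (R : realType) (n : nat) (delta beta mu lam t : R)
    (k : 'cV[int]_n) : 'M[R]_n :=
  multiplier_fun delta beta mu lam (fun l => cos (Num.sqrt (- l) * t)) k.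

Definition sin_sqrtN_mx (R : realType) (n : nat) (delta beta mu lam t : R)
    (k : 'cV[int]_n) : 'M[R]_n :=
  multiplier_fun delta beta mu lam (fun l => sin (Num.sqrt (- l) * t)) k.

(* [R[i]^o] is the complex line as a normed space over itself, which gives
   C^n the topology used for sums and derivatives below. *)
Notation Cvec R n := ('cV[R[i]^o]_n).

Definition real_mx (R : realType) (n : nat) (A : 'M[R]_n) : 'M[R[i]]_n :=
  map_mx (real_complex R) A.

Definition sol_term (R : realType) (n : nat) (delta beta mu lam : R)
    (f g : periodic_distribution R n) (x : 'cV[R]_n) (t : R)
    (k : {k : 'cV[int]_n | k != 0}) : Cvec R n :=
  expi (dot (freq R (val k)) x) *:
   (real_mx (cos_sqrtN_mx delta beta mu lam t (val k)) *m fourier_coef f (val k)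
    + real_mx (sin_sqrtN_mx delta beta mu lam t (val k)
               *m invmx (sqrtN_mx delta beta mu lam (val k)))
      *m fourier_coef g (val k)).

(* [partial_sum F @ totally] is the net of the sums of F over finite sets of
   indices and [sum F] is its limit. *)
Definition sums_converge (R : realType) (n : nat) (I : choiceType)
    (F : I -> Cvec R n) : Prop :=
  cvg (summability.partial_sum F @ summability.totally).

Definition solution (R : realType) (n : nat) (delta beta mu lam : R)
    (f g : periodic_distribution R n) (x : 'cV[R]_n) (t : R) : Cvec R n :=
  (fourier_coef f 0 + t%:C *: fourier_coef g 0)
  + summability.sum (sol_term delta beta mu lam f g x t).

Definition derivative_within (R : realType) (n : nat) (D : set R)
    (v : R -> Cvec R n) (t : R) (d : Cvec R n) : Prop :=
  ((h^-1)%:C *: (v (t + h) - v t)) @[h --> within [set h | D (t + h)] 0^'] --> d.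

(* On an interval of positive length the derivatives [d i] are unique on D;
   they are one-sided at the end points that belong to D. *)
Definition smooth_curve_on (R : realType) (n : nat) (D : set R)
    (v : R -> Cvec R n) : Prop :=
  exists d : nat -> R -> Cvec R n,
    (forall t, D t -> d 0%N t = v t) /\
    (forall i t, D t -> derivative_within D (d i) t (d i.+1 t)).

(* Main.v *)
Require Import Defs.
From mathcomp Require Import all_boot all_order all_algebra.
From mathcomp Require Import all_classical all_reals all_analysis.
From mathcomp Require Import finmap complex ring lra.
From mathcomp.analysis.showcase Require summability.
Set Implicit Arguments.
Unset Strict Implicit.
Unset Printing Implicit Defensive.
Import Order.TTheory GRing.Theory Num.Theory.
Import numFieldNormedType.Exports.
Local Open Scope classical_set_scope.
Local Open Scope ring_scope.

Import summability.

(** For beta = n the eigenvalues of the multiplier grow only logarithmically: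
    |lambda_i(k)| = O(1 + ln(1 + |k|^2)).  Each time derivative of the solution
    multiplies the k-th Fourier mode by a further factor
    a = sqrt(- lambda_i(k)), so every derivative costs less than any power
    of |k|, and the decay of the Fourier coefficients encoded in H^s with
    s > n absorbs all of them at once.

    _Growth of the eigenvalues._  Put y = |nu|^2 delta^2 / 4.  When beta = n,
    some upper parameters equal 1 and some lower ones equal 2, and the
    hypergeometric series reduce to three functions:
    [bessel b y] = 0F1(; b; - y), [bessel_mean c y] = 1F2(1; 2, c; - y) and
    [bessel_log c y] = y 2F3(1, 1; 2, 2, c; - y), whose derivative is
    [bessel_mean c].  The function G = 0F1(; b; - y) solves
    y G'' + b G' + G = 0, and the energy G^2 + y G'^2 is nonincreasing when
    b >= 1/2, so |G| <= 1 ([bessel_le1]).  Since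
    y [bessel_mean c y] = (c - 1) (1 - 0F1(; c - 1; - y)), it follows that
    [bessel_mean c] is O(1 / (1 + y)) and, integrating, that [bessel_log c] is
    O(ln (1 + y)) ([bessel_mean_bound], [bessel_log_bound]).  Hence
    |lambda_i(nu)| <= C (1 + |nu|^2)^eta for every eta > 0
    ([lambda1_bound], [lambda2_bound]).

    _Summability._  With X = 1 + |k|^2, the weighted inequality
    c u <= X^s u^2 + c^2 / X^s separates the Sobolev norm from
    (1 + a)^(2 i) / X^s <= C X^(- n), and X^(- n) is at most the product of
    the 1 / (1 + k_j^2), whose sum over Z^n is finite
    ([sobolev_majorant]).

    _Termwise differentiation._  The i-th derivative of a mode consists of
    functions a^i cos (a t + i pi / 2 + phi), for which the error of the
    difference quotient is at most 2 |h| a^(i + 2).  Summing these explicit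
    errors over k differentiates the series term by term
    ([termwise_derivative]), and this applies to every order i. *)

(** * Power series with coefficients of exponential type *)

Section PowerSeries.
Variable R : realType.
Implicit Types (a : R ^nat) (x : R).

Definition psum a x : R := limn (pseries a x).

(** A class of entire series that is stable under formal differentiation. *)
Definition exp_type a : Prop :=
  exists C : R, forall m, `|a m| <= C * (2 ^+ m / (m`!)%:R).

Lemma exp_type_cvg a x : exp_type a -> cvgn (pseries a x).
Proof.
move=> [C aC]; apply: normed_cvg.
apply: (@series_le_cvg _ _ (fun m => C * exp_coeff (2 * `|x|) m)) => //.
- by move=> m /=; exact: normr_ge0.
- move=> m /=; apply: mulr_ge0; last first.
    by rewrite divr_ge0 ?exprn_ge0 ?mulr_ge0.
  have /(le_trans (normr_ge0 _)) := aC 0%N.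
  by rewrite expr0 fact0 divr1 mulr1.
- move=> m /=; rewrite /exp_coeff /= normrM normrX exprMn.
  by rewrite mulrAC mulrA ler_wpM2r ?exprn_ge0.
- have -> : (fun m => C * exp_coeff (2 * `|x|) m) = C *: exp_coeff (2 * `|x|).
    by [].
  exact/is_cvg_seriesZ/is_cvg_series_exp_coeff.
Qed.

#[local] Arguments exp_type_cvg {a} x.

Lemma exp_type_diffs a : exp_type a -> exp_type (pseries_diffs a).
Proof.
move=> [C aC]; exists (2 * C) => m; rewrite /pseries_diffs normrM normr_nat.
apply: le_trans (_ : m.+1%:R * (C * (2 ^+ m.+1 / (m.+1)`!%:R)) <= _).
  by rewrite ler_wpM2l.
rewrite factS natrM exprS invfM.
have m0 : m.+1%:R != 0 :> R by rewrite pnatr_eq0.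
rewrite le_eqVlt; apply/orP; left; apply/eqP; field.
by rewrite nat1r m0 pnatr_eq0 -lt0n fact_gt0.
Qed.

Lemma exp_typeD a b : exp_type a -> exp_type b -> exp_type (a + b).
Proof.
move=> [C aC] [D bD]; exists (C + D) => m.
by rewrite mulrDl (le_trans (ler_normD _ _))// lerD.
Qed.

Lemma exp_typeZ k a : exp_type a -> exp_type (k *: a).
Proof.
move=> [C aC]; exists (`|k| * C) => m.
by rewrite normrM -mulrA ler_wpM2l.
Qed.

Lemma exp_type_le a b : exp_type b -> (forall m, `|a m| <= `|b m|) ->
  exp_type a.
Proof. by move=> [C bC] ab; exists C => m; exact: le_trans (ab m) (bC m). Qed.

Lemma psumD a b x : exp_type a -> exp_type b ->
  psum (a + b) x = psum a x + psum b x.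
Proof.
move=> ea eb; have E : (fun m => (a + b) m * x ^+ m) =
    (fun m => a m * x ^+ m) + (fun m => b m * x ^+ m).
  by apply/funext => m /=; rewrite mulrDl.
rewrite /psum /pseries E lim_seriesD//; [exact: (exp_type_cvg x ea)|].
exact: (exp_type_cvg x eb).
Qed.

Lemma psumZ k a x : exp_type a -> psum (k *: a) x = k * psum a x.
Proof.
move=> ea; have E : (fun m => (k *: a) m * x ^+ m) =
    k *: (fun m => a m * x ^+ m).
  by apply/funext => m /=; rewrite -mulrA.
by rewrite /psum /pseries E lim_seriesZ//; exact: (exp_type_cvg x ea).
Qed.

Lemma psum_shift a x : exp_type a ->
  psum a x = a 0%N + x * psum (fun m => a m.+1) x.
Proof.
move=> ea; have ca := exp_type_cvg x ea.
have es : exp_type (fun m => a m.+1).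
  apply: exp_type_le (exp_type_diffs ea) _ => m.
  by rewrite normrM normr_nat ler_peMl// ler1n.
have cs := exp_type_cvg x es.
rewrite [LHS]/psum; apply/cvg_lim => //; rewrite -cvg_shiftS.
rewrite (_ : (fun n => _) =
    (fun n => a 0%N + x * pseries (fun m => a m.+1) x n)); last first.
  apply/funext => n; rewrite /pseries /series /= big_nat_recl//= expr0 mulr1.
  rewrite mulr_sumr; congr (_ + _); apply: eq_bigr => i _.
  by rewrite exprS mulrCA.
by apply: cvgD; [exact: cvg_cst|apply: cvgMl_tmp; exact: (exp_type_cvg x es)].
Qed.

Lemma psum0 a : exp_type a -> psum a 0 = a 0%N.
Proof. by move=> ea; rewrite psum_shift// mul0r addr0. Qed.

Lemma is_derive_psum a x : exp_type a ->
  is_derive x 1 (psum a) (psum (pseries_diffs a) x).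
Proof.
move=> ea; have e1 := exp_type_diffs ea; have e2 := exp_type_diffs e1.
apply: (@pseries_snd_diffs _ _ (`|x| + 1)).
- exact: exp_type_cvg.
- exact: exp_type_cvg.
- exact: exp_type_cvg.
- by rewrite [ltRHS]ger0_norm ?addr_ge0// ltrDl.
Qed.

End PowerSeries.

(** * Bessel functions as hypergeometric series *)
Section MeanValue.
Variable R : realType.

Lemma le_of_derive_le0 (f df : R -> R) (x : R) :
  (forall y : R, 0 <= y -> is_derive y (1 : R) f (df y)) ->
  (forall y, 0 <= y -> df y <= 0) -> 0 <= x -> f x <= f 0.
Proof.
move=> fdf df0 x0.
have cf : {within `[0, x], continuous f}.
  apply: continuous_in_subspaceT => y /set_mem.
  rewrite /= in_itv/= => /andP[y0 _].
  by apply/differentiable_continuous/derivable1_diffP; have [] := fdf y y0.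
have [|c] := @MVT_segment _ f df 0 x x0 _ cf.
  by move=> y /[!in_itv]/= /andP[/ltW y0 _]; exact: fdf.
rewrite in_itv/= => /andP[c0 _] /eqP; rewrite subr_eq subr0 => /eqP ->.
by rewrite gerDr mulr_le0_ge0// df0.
Qed.

End MeanValue.
Section Bessel.
Variable R : realType.
Implicit Types (b c y : R).

Lemma rising0 b : rising b 0 = 1.
Proof. by rewrite /rising big_ord0. Qed.

Lemma risingSr b m : rising b m.+1 = rising b m * (b + m%:R).
Proof. by rewrite /rising big_ord_recr. Qed.

Lemma risingSl b m : rising b m.+1 = b * rising (b + 1) m.
Proof.
rewrite /rising big_ord_recl addr0; congr (_ * _).
by apply: eq_bigr => i _; rewrite lift0 -nat1r addrA.
Qed.

Lemma rising_gt0 b m : 0 < b -> 0 < rising b m.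
Proof. by move=> b0; apply: prodr_gt0 => i _; rewrite ltr_wpDr. Qed.

(** The condition b >= 1/2, natural for the energy argument, also puts the
    coefficients in the class of series above. *)
Lemma rising_ge b m : 1 / 2 <= b -> (2 ^+ m)^-1 <= rising b m.
Proof.
move=> b0; elim: m => [|m IH]; first by rewrite rising0 expr0 invr1.
rewrite risingSr exprSr invfM ler_pM// ?invr_ge0 ?exprn_ge0//.
by rewrite -[_^-1]mul1r (le_trans b0)// lerDl.
Qed.

Lemma rising1 m : rising 1 m = m`!%:R :> R.
Proof.
elim: m => [|m IH]; first by rewrite rising0.
by rewrite risingSr IH factS natrM mulrC nat1r.
Qed.

Lemma rising2 m : rising 2 m = m.+1`!%:R :> R.
Proof.
have := risingSl (1 : R) m; rewrite mul1r rising1.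
by have -> : 1 + 1 = 2 :> R by []; move=> ->.
Qed.

(** Coefficients of 0F1(; b; - y).  The sign of the argument is part of the
    coefficients, so that differentiation is with respect to y itself. *)
Definition bessel_coef b m : R := (-1) ^+ m / (m`!%:R * rising b m).

Lemma fact_neq0 m : m`!%:R != 0 :> R.
Proof. by rewrite pnatr_eq0 -lt0n fact_gt0. Qed.

Lemma exp_type_bessel b : 1 / 2 <= b -> exp_type (bessel_coef b).
Proof.
move=> b0; exists 1 => m; rewrite mul1r normrM normrX normrN1 expr1n mul1r.
rewrite ger0_norm; last first.
  by rewrite invr_ge0 mulr_ge0// ltW// rising_gt0//; lra.
rewrite invfM mulrC ler_wpM2r ?invr_ge0//.
rewrite -[leRHS]invrK lef_pV2 ?posrE ?invr_gt0 ?exprn_gt0 ?rising_gt0//;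
  last lra.
exact: rising_ge.
Qed.

Definition bessel b y : R := psum (bessel_coef b) y.

Lemma bessel0 b : 1 / 2 <= b -> bessel b 0 = 1.
Proof.
move=> b0; rewrite /bessel psum0; last exact: exp_type_bessel.
by rewrite /bessel_coef rising0 fact0 mulr1 divr1 expr0.
Qed.

Lemma bessel_coef_diffs b : 1 / 2 <= b ->
  pseries_diffs (bessel_coef b) = - b^-1 *: bessel_coef (b + 1).
Proof.
move=> b0; apply/funext => m; rewrite /pseries_diffs.
rewrite -[RHS]/(- b^-1 * bessel_coef (b + 1) m) /bessel_coef.
rewrite exprS risingSl factS natrM.
have b1 : b != 0 by rewrite gt_eqF//; lra.
have r0 : rising (b + 1) m != 0 by rewrite gt_eqF// rising_gt0//; lra.
have f0 := fact_neq0 m.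
have m0 : m.+1%:R != 0 :> R by rewrite pnatr_eq0.
by field; rewrite b1 r0 f0 nat1r m0.
Qed.

Lemma is_derive_bessel b y : 1 / 2 <= b ->
  is_derive y 1 (bessel b) (- b^-1 * bessel (b + 1) y).
Proof.
move=> b0; have := is_derive_psum y (exp_type_bessel b0).
rewrite bessel_coef_diffs// psumZ//; apply: exp_type_bessel; lra.
Qed.

(** The equation y G'' + b G' + G = 0 for G = 0F1(; b; - y), written as a
    relation between contiguous functions: G' = - 0F1(; b + 1; - y) / b. *)
Lemma bessel_ode b y : 1 / 2 <= b ->
  bessel (b + 1) y - bessel b y = y * ((b * (b + 1))^-1 * bessel (b + 2) y).
Proof.
move=> b0; have b1 : 1 / 2 <= b + 1 by lra.
have b2 : 1 / 2 <= b + 2 by lra.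
have e0 := exp_type_bessel b0; have e1 := exp_type_bessel b1.
have e2 := exp_type_bessel b2.
rewrite /bessel -psumZ// -mulN1r -psumZ// -psumD//; last exact: exp_typeZ.
rewrite psum_shift; last by apply: exp_typeD => //; exact: exp_typeZ.
rewrite -[(bessel_coef _ + _) 0%N]
  /(bessel_coef (b + 1) 0 + -1 * bessel_coef b 0).
rewrite {1 2}/bessel_coef !rising0 mulN1r subrr add0r.
apply: (congr1 (fun a => y * psum a y)).
apply/funext => m.
rewrite -[LHS]/(bessel_coef (b + 1) m.+1 + -1 * bessel_coef b m.+1).
rewrite -[RHS]/((b * (b + 1))^-1 * bessel_coef (b + 2) m) /bessel_coef.
have b00 : b != 0 by rewrite gt_eqF//; lra.
have b10 : b + 1 != 0 by rewrite gt_eqF//; lra.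
have r0 : rising (b + 2) m != 0 by rewrite gt_eqF// rising_gt0//; lra.
have bm : b + 1 + m%:R != 0.
  by rewrite gt_eqF//; have : 0 <= m%:R :> R by []; lra.
have m0 : m.+1%:R != 0 :> R by rewrite pnatr_eq0.
have f0 := fact_neq0 m.
have b11 : b + 1 + 1 = b + 2 by ring.
have E1 : rising (b + 1) m = (b + 1) * rising (b + 2) m / (b + 1 + m%:R).
  have := risingSl (b + 1) m; rewrite risingSr b11 => <-.
  by rewrite mulfK.
rewrite [rising b _]risingSl [rising (b + 1) m.+1]risingSl E1 b11.
rewrite exprS factS natrM.
by field; rewrite b00 b10 r0 f0 nat1r m0 bm.
Qed.

(** Along a solution of y G'' + b G' + G = 0, the energy G^2 + y G'^2 has
    derivative (1 - 2 b) G'^2; its value at 0 does not involve G'(0), because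
    of the weight y. *)
Lemma energy_le (G G1 G2 : R -> R) b y :
  (forall z : R, is_derive z (1 : R) G (G1 z)) ->
  (forall z : R, is_derive z (1 : R) G1 (G2 z)) ->
  (forall z, z * G2 z + b * G1 z + G z = 0) ->
  1 / 2 <= b -> 0 <= y -> G y ^+ 2 <= G 0 ^+ 2.
Proof.
move=> dG dG1 ode b0 y0.
have dE z : is_derive z (1 : R) (G ^+ 2 + id * (G1 ^+ 2))
    ((1 - 2 * b) * G1 z ^+ 2).
  apply: (is_derive_eq (is_deriveD (is_deriveX 2 (dG z))
    (is_deriveM (is_derive_id z 1) (is_deriveX 2 (dG1 z))))).
  rewrite /GRing.scale /= -[(G1 ^+ 2) z]/(G1 z ^+ 2).
  have -> : G z = - (z * G2 z + b * G1 z) by rewrite -[RHS]addr0 -(ode z); ring.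
  ring.
have := @le_of_derive_le0 _ _ (fun z => (1 - 2 * b) * G1 z ^+ 2) y
  (fun z _ => dE z).
have -> : (G ^+ 2 + id * G1 ^+ 2) y = G y ^+ 2 + y * G1 y ^+ 2 by [].
have -> : (G ^+ 2 + id * G1 ^+ 2) 0 = G 0 ^+ 2 + 0 * G1 0 ^+ 2 by [].
rewrite mul0r addr0 => /(_ _ y0) H; apply: le_trans (H _).
  by rewrite lerDl mulr_ge0// sqr_ge0.
by move=> z _; rewrite mulr_le0_ge0 ?sqr_ge0//; lra.
Qed.

Lemma bessel_le1 b y : 1 / 2 <= b -> 0 <= y -> `|bessel b y| <= 1.
Proof.
move=> b0 y0; have b1 : 1 / 2 <= b + 1 by lra.
pose G1 y := - b^-1 * bessel (b + 1) y.
pose G2 y := - b^-1 * (- (b + 1)^-1 * bessel (b + 2) y).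
have dG1 z : is_derive z (1 : R) G1 (G2 z).
  have b11 : b + 1 + 1 = b + 2 by ring.
  have := is_derive_bessel z b1; rewrite b11 => ?.
  exact: is_deriveZ.
have b00 : b != 0 by rewrite gt_eqF//; lra.
have b10 : b + 1 != 0 by rewrite gt_eqF//; lra.
have ode z : z * G2 z + b * G1 z + bessel b z = 0.
  have E := bessel_ode z b0.
  have {}E : bessel b z =
      bessel (b + 1) z - z * ((b * (b + 1))^-1 * bessel (b + 2) z).
    by rewrite -E; ring.
  by rewrite E /G1 /G2; field; rewrite b00 b10.
have := energy_le (fun z => is_derive_bessel z b0) dG1 ode b0 y0.
by rewrite bessel0// expr1n -(real_normK (num_real _)) expr_le1.
Qed.

(** Coefficients of 1F2(1; 2, c; - y), which is the mean over [0, y] of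
    0F1(; c; - z). *)
Definition bessel_mean_coef c m : R := (-1) ^+ m / (m.+1`!%:R * rising c m).

(** Coefficients of 2F3(1, 1; 2, 2, c; - y). *)
Definition bessel_log_coef c m : R :=
  (-1) ^+ m / (m.+1%:R * m.+1`!%:R * rising c m).

Lemma exp_type_bessel_mean c : 1 / 2 <= c -> exp_type (bessel_mean_coef c).
Proof.
move=> c0; apply: exp_type_le (exp_type_bessel c0) _ => m.
have r0 : 0 < rising c m by apply: rising_gt0; lra.
have f0 k : 0 < k`!%:R :> R by rewrite ltr0n fact_gt0.
rewrite !normrM ler_wpM2l// !gtr0_norm ?invr_gt0 ?mulr_gt0//.
rewrite lef_pV2 ?posrE ?mulr_gt0// ler_pM2r//.
by rewrite ler_nat factS leq_pmull.
Qed.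

Lemma exp_type_bessel_log c : 1 / 2 <= c -> exp_type (bessel_log_coef c).
Proof.
move=> c0; apply: exp_type_le (exp_type_bessel_mean c0) _ => m.
have r0 : 0 < rising c m by apply: rising_gt0; lra.
have f0 k : 0 < k`!%:R :> R by rewrite ltr0n fact_gt0.
rewrite !normrM ler_wpM2l// !gtr0_norm ?invr_gt0 ?mulr_gt0//.
rewrite lef_pV2 ?posrE ?mulr_gt0// ler_pM2r//.
by rewrite ler_pMl// ler1n.
Qed.

Definition bessel_mean c y : R := psum (bessel_mean_coef c) y.
(** The factor y makes this an antiderivative of [bessel_mean c]; it is the
    source of the logarithm. *)
Definition bessel_log c y : R := y * psum (bessel_log_coef c) y.

(** Integrating 0F1(; c; - z) over [0, y] with the rule
    d/dz 0F1(; c - 1; - z) = - 0F1(; c; - z) / (c - 1). *)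
Lemma bessel_meanE c y : 3 / 2 <= c ->
  y * bessel_mean c y = (c - 1) * (1 - bessel (c - 1) y).
Proof.
move=> c0; have c1 : 1 / 2 <= c - 1 by lra.
have c2 : 1 / 2 <= c by lra.
have c10 : c - 1 != 0 by rewrite gt_eqF//; lra.
have -> : bessel (c - 1) y = 1 + y * (- (c - 1)^-1 * bessel_mean c y).
  rewrite [LHS](psum_shift _ (exp_type_bessel c1)) {1}/bessel_coef.
  rewrite rising0 fact0 mulr1 divr1 expr0; congr (1 + y * _).
  rewrite /bessel_mean -psumZ; last exact: exp_type_bessel_mean.
  apply: (congr1 (fun a => psum a y)); apply/funext => m.
  rewrite -[RHS]/(- (c - 1)^-1 * bessel_mean_coef c m).
  rewrite /bessel_coef /bessel_mean_coef risingSl subrK exprS.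
  have r0 : rising c m != 0 by rewrite gt_eqF// rising_gt0//; lra.
  have f0 := fact_neq0 m.+1.
  by field; rewrite r0 c10 f0.
by field.
Qed.

(** With G = 0F1(; c - 1; - y), the relation y F = (c - 1) (1 - G) gives
    y F <= 2 (c - 1) from |G| <= 1, and 0 <= F <= 1 from
    0 <= 1 - G <= y / (c - 1); the two bounds add up. *)
Lemma bessel_mean_bound c y : 3 / 2 <= c -> 0 <= y ->
  0 <= bessel_mean c y <= (2 * c - 1) / (1 + y).
Proof.
move=> c0 y0; have c1 : 1 / 2 <= c - 1 by lra.
have c2 : 1 / 2 <= c by lra.
have c10 : 0 < c - 1 by lra.
have := y0; rewrite le_eqVlt => /orP[/eqP <-|y1].
  rewrite /bessel_mean psum0; last exact: exp_type_bessel_mean.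
  rewrite /bessel_mean_coef rising0 expr0 factS fact0 addr0.
  by apply/andP; split; lra.
have G1 : `|bessel (c - 1) y| <= 1 by apply: bessel_le1.
have G2 : 1 - bessel (c - 1) y <= (c - 1)^-1 * y.
  have c11 : c - 1 + 1 = c by ring.
  have := @le_of_derive_le0 _ (fun z => - bessel (c - 1) z - (c - 1)^-1 * z)
    (fun z => (c - 1)^-1 * (bessel c z - 1)) y _ _ y0.
  rewrite bessel0// mulr0 subr0 => H.
  suff: - bessel (c - 1) y - (c - 1)^-1 * y <= - 1 by lra.
  apply: H => z z0.
    have := is_derive_bessel z c1; rewrite c11 => D.
    apply: (is_derive_eq (is_deriveB (is_deriveN D)
       (is_deriveZ (c - 1)^-1 (is_derive_id z 1)))).
    by rewrite /GRing.scale/=; ring.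
  rewrite pmulr_rle0 ?invr_gt0// subr_le0.
  by have := bessel_le1 c2 z0; rewrite ler_norml => /andP[].
have E := bessel_meanE y c0.
have F1 : 0 <= y * bessel_mean c y <= y.
  rewrite E; move: G1; rewrite ler_norml => /andP[G3 G4].
  rewrite pmulr_rge0// subr_ge0 G4/= -(ler_pM2l (x := (c - 1)^-1)) ?invr_gt0//.
  by rewrite mulKf ?gt_eqF.
have F2 : y * bessel_mean c y <= 2 * (c - 1).
  by rewrite E mulrC ler_pM2r//; move: G1; rewrite ler_norml => /andP[]; lra.
move: F1 => /andP[F0 F1]; rewrite ler_pdivlMr; last lra.
rewrite pmulr_rge0// in F0; rewrite F0/=.
have F3 : bessel_mean c y <= 1 by rewrite -(ler_pM2l y1) mulr1.
by rewrite mulrDr mulr1 mulrC; lra.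
Qed.

(** Shifting the coefficients by one index turns y 2F3 into a power series
    whose formal derivative has the coefficients of 1F2. *)
Lemma is_derive_bessel_log c y : 3 / 2 <= c ->
  is_derive y 1 (bessel_log c) (bessel_mean c y).
Proof.
move=> c0; have c2 : 1 / 2 <= c by lra.
pose k m := if m is m'.+1 then bessel_log_coef c m' else 0.
have ek : exp_type k.
  exists 1 => m; rewrite mul1r.
  case: m => [|m]; first by rewrite /k normr0 divr_ge0.
  have r0 : 0 < rising c m by apply: rising_gt0; lra.
  have f0 : 0 < m.+1`!%:R :> R by rewrite ltr0n fact_gt0.
  rewrite /k /bessel_log_coef normrM normrX normrN1 expr1n mul1r.
  rewrite gtr0_norm ?invr_gt0 ?mulr_gt0//.
  rewrite invfM mulrC ler_pM ?invr_ge0 ?(ltW r0) ?mulr_ge0 ?(ltW f0)//.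
    rewrite invf_ple ?posrE ?exprn_gt0//; apply: le_trans (rising_ge m c2).
    by rewrite lef_pV2 ?posrE ?exprn_gt0// ler_eXn2l ?ltr1n.
  by rewrite lef_pV2 ?posrE ?mulr_gt0// ler_pMl// ler1n.
have -> : bessel_log c = psum k.
  by apply/funext => z; rewrite (psum_shift z ek) add0r.
rewrite (_ : bessel_mean c y = psum (pseries_diffs k) y).
  exact: is_derive_psum.
apply: (congr1 (fun a => psum a y)); apply/funext => m.
rewrite /pseries_diffs /k /bessel_log_coef /bessel_mean_coef.
have r0 : rising c m != 0 by rewrite gt_eqF// rising_gt0//; lra.
have f0 := fact_neq0 m.+1; have m0 : m.+1%:R != 0 :> R by rewrite pnatr_eq0.
by field; rewrite r0 f0 nat1r m0.
Qed.

Lemma bessel_log_bound c y : 3 / 2 <= c -> 0 <= y ->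
  0 <= bessel_log c y <= (2 * c - 1) * ln (1 + y).
Proof.
move=> c0 y0.
have K0 : bessel_log c 0 = 0 by rewrite /bessel_log mul0r.
have L0 : ln (1 + 0) = 0 :> R by rewrite addr0 ln1.
apply/andP; split.
  have := @le_of_derive_le0 _ (- bessel_log c) (fun z => - bessel_mean c z) y
    _ _ y0.
  rewrite -[(- bessel_log c) y]/(- bessel_log c y).
  rewrite -[(- bessel_log c) 0]/(- bessel_log c 0) K0 oppr0 oppr_le0; apply.
    by move=> z _; apply: is_deriveN; exact: is_derive_bessel_log.
  by move=> z z0; rewrite oppr_le0; have /andP[] := bessel_mean_bound c0 z0.
have := @le_of_derive_le0 _ (fun z => bessel_log c z - (2 * c - 1) * ln (1 + z))
   (fun z => bessel_mean c z - (2 * c - 1) * (1 + z)^-1) y _ _ y0.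
rewrite K0 L0 mulr0 subr0 subr_le0; apply => z z0.
  apply: (is_deriveB (is_derive_bessel_log z c0)).
  apply: is_deriveZ.
  have z1 : 0 < 1 + z by lra.
  have D1 : is_derive z (1:R) (fun z => 1 + z) 1.
    have := is_deriveD (is_derive_cst (1 : R) z 1) (is_derive_id z 1).
    by rewrite add0r.
  have D2 := is_derive1_ln z1.
  by apply: (is_derive_eq (is_derive1_comp D2 D1)); rewrite mulr1.
by rewrite subr_le0; have /andP[] := bessel_mean_bound c0 z0.
Qed.

End Bessel.
(** * Logarithmic growth of the eigenvalues *)
Section Multipliers.
Variable R : realType.
Implicit Types (c y : R).

Lemma hypergeometric_psum (a b : seq R) (u : R ^nat) y :
  (forall m, (\prod_(c <- a) rising c m) / (\prod_(c <- b) rising c m)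
     * ((-1) ^+ m / (m`!)%:R) = u m) ->
  hypergeometric a b (- y) = psum u y.
Proof.
move=> E; rewrite /hypergeometric /psum /pseries.
apply: (congr1 (fun s : R ^nat => limn (series s))); apply/funext => m.
rewrite /= -E (exprNn y).
move: ((-1) ^+ m) (y ^+ m) (_ / _) => p q r; ring.
Qed.

Lemma hypergeometric12 c y : 1 / 2 <= c ->
  hypergeometric [:: 1] [:: c; 2] (- y) = bessel_mean c y.
Proof.
move=> c0; apply: hypergeometric_psum => m.
rewrite !big_cons !big_nil rising1 rising2 /bessel_mean_coef.
have r0 : rising c m != 0 by rewrite gt_eqF// rising_gt0//; lra.
by field; rewrite r0 !fact_neq0.
Qed.

Lemma hypergeometric23 c y : 1 / 2 <= c ->
  y * hypergeometric [:: 1; 1] [:: 2; c; 2] (- y) = bessel_log c y.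
Proof.
move=> c0; congr (_ * _); apply: hypergeometric_psum => m.
rewrite !big_cons !big_nil rising1 rising2 /bessel_log_coef.
have r0 : rising c m != 0 by rewrite gt_eqF// rising_gt0//; lra.
rewrite factS natrM; have m0 : m.+1%:R != 0 :> R by rewrite pnatr_eq0.
by field; rewrite r0 !fact_neq0 nat1r m0.
Qed.

(** Since (5/2)_m / (3/2)_m = 1 + 2 m / 3, the coefficients split into those
    of 2F3 and, m + 1 cancelling one denominator, those of 1F2:
    1 + 2 m / 3 = 1 / 3 + 2 (m + 1) / 3. *)
Lemma hypergeometric34 c y : 1 / 2 <= c ->
  y * hypergeometric [:: 1; 5 / 2; 1] [:: 2; 3 / 2; c; 2] (- y) =
  1 / 3 * bessel_log c y + 2 / 3 * (y * bessel_mean c y).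
Proof.
move=> c0; have e1 := exp_type_bessel_log c0.
have e2 := exp_type_bessel_mean c0.
rewrite /bessel_log !(mulrCA _ y) -mulrDr; congr (_ * _).
rewrite /bessel_mean -psumZ// -[X in _ = _ + X]psumZ// -psumD;
  [|exact: exp_typeZ..].
apply: hypergeometric_psum => m.
rewrite -[RHS]/(1 / 3 * bessel_log_coef c m + 2 / 3 * bessel_mean_coef c m).
rewrite !big_cons !big_nil rising1 rising2 /bessel_log_coef /bessel_mean_coef.
have r0 : rising c m != 0 by rewrite gt_eqF// rising_gt0//; lra.
have r3 : rising (3 / 2) m != 0 :> R by rewrite gt_eqF// rising_gt0//; lra.
have -> : rising (5 / 2) m = (1 + 2 / 3 * m%:R) * rising (3 / 2) m :> R.
  have E : 3 / 2 + 1 = 5 / 2 :> R by field.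
  apply: (mulfI (x := 3 / 2)); first by rewrite gt_eqF//; lra.
  by rewrite -E -risingSl risingSr; field.
rewrite factS natrM; have m0 : m.+1%:R != 0 :> R by rewrite pnatr_eq0.
by rewrite -nat1r in m0 *; field; rewrite r0 r3 !fact_neq0 m0.
Qed.

Lemma sqnorm_ge0 n (v : 'cV[R]_n) : 0 <= sqnorm v.
Proof. by rewrite /sqnorm /dot sumr_ge0// => j _; rewrite -expr2 sqr_ge0. Qed.

(** The factor |nu|^2 = 4 y / delta^2 in front of the series is what turns 2F3
    into [bessel_log]. *)
Lemma lambda2_bessel n (delta mu : R) (nu : 'cV[R]_n) :
  let y := 1 / 4 * (sqnorm nu * delta ^+ 2) in
  delta ^+ 2 / 4 * lambda2 delta n%:R mu nu =
  - mu * bessel_log ((n%:R + 4) / 2) y.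
Proof.
move=> y; rewrite /lambda2 -hypergeometric23; last first.
  by have : 0 <= n%:R :> R by []; lra.
rewrite (mulNr (1 / 4)) -/y.
have -> : (n%:R + 2 - n%:R) / 2 = 1 :> R by field.
have -> : (n%:R + 4 - n%:R) / 2 = 2 :> R by field.
by rewrite /y; ring.
Qed.

Lemma lambda1_bessel n (delta mu lam : R) (nu : 'cV[R]_n) :
  let y := 1 / 4 * (sqnorm nu * delta ^+ 2) in
  let c := (n%:R + 4) / 2 in
  delta ^+ 2 / 4 * lambda1 delta n%:R mu lam nu =
  - (mu * (bessel_log c y + 2 * (y * bessel_mean c y)) +
     (lam - mu) * (y * bessel_mean ((n%:R + 2) / 2) y ^+ 2)).
Proof.
move=> y c; rewrite /lambda1; have n0 : 0 <= n%:R :> R by [].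
have -> : (n%:R + 2 - n%:R) / 2 = 1 :> R by field.
have -> : (n%:R + 4 - n%:R) / 2 = 2 :> R by field.
rewrite (mulNr (1 / 4)) -/y -/c hypergeometric12; last lra.
have := @hypergeometric34 c y; rewrite /c => /(_ ltac:(lra)).
set H := hypergeometric _ _ _; set L := bessel_log _ _.
set F := bessel_mean _ _.
set F2 := bessel_mean _ _ => E.
have -> : L + 2 * (y * F) = 3 * (y * H) by rewrite E; field.
by rewrite /y; field.
Qed.

Lemma ln_le_powR (eta x : R) : 0 < eta -> 1 <= x -> ln x <= eta^-1 * x `^ eta.
Proof.
move=> e0 x1; have x0 : 0 < x by lra.
have := ln_sublinear (powR_gt0 eta x0); rewrite ln_powR => H.
by rewrite -(ler_pM2l e0) mulVKf ?gt_eqF// ltW.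
Qed.

(** A logarithm is dominated by every positive power; the constant takes care
    of the scale delta. *)
Lemma ln_sqnorm_bound (delta eta : R) : 0 < eta -> exists2 C, 0 <= C &
  forall s : R, 0 <= s ->
    1 + ln (1 + 1 / 4 * (s * delta ^+ 2)) <= C * (1 + s) `^ eta.
Proof.
move=> e0; pose D := 1 + 1 / 4 * delta ^+ 2.
have d0 : 0 <= delta ^+ 2 by exact: sqr_ge0.
exists (1 + eta^-1 * D `^ eta).
  by rewrite addr_ge0// mulr_ge0 ?powR_ge0// invr_ge0 ltW.
move=> s s0; rewrite mulrDl; apply: lerD.
  have s1 : 1 <= 1 + s by rewrite lerDl.
  by have := ler_powR s1 (ltW e0); rewrite powRr0 mul1r.
have sd : 0 <= s * delta ^+ 2 by rewrite mulr_ge0.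
apply: le_trans (ln_le_powR e0 _) _; first lra.
rewrite -(mulrA eta^-1) ler_pM2l ?invr_gt0// -powRM; [|rewrite /D; lra|lra].
apply: ge0_ler_powR; rewrite ?nnegrE; [exact: ltW|lra|..].
  by rewrite /D mulr_ge0; lra.
by rewrite /D; nra.
Qed.

Lemma lambda2_bound n (delta mu : R) (eta : R) : 0 < delta -> 0 < eta ->
  exists2 C, 0 <= C & forall nu : 'cV[R]_n,
    `|lambda2 delta n%:R mu nu| <= C * (1 + sqnorm nu) `^ eta.
Proof.
move=> d0 e0; have [C C0 HC] := ln_sqnorm_bound delta e0.
have d1 : 0 < delta ^+ 2 / 4 by rewrite divr_gt0 ?exprn_gt0.
have n0 : 0 <= n%:R :> R by [].
exists ((delta ^+ 2 / 4)^-1 * (`|mu| * (n%:R + 3) * C)).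
  by rewrite !mulr_ge0// ?invr_ge0 ?(ltW d1)// addr_ge0.
move=> nu; rewrite -(mulrA _^-1) -(ler_pM2l d1) mulVKf ?gt_eqF//.
rewrite -[X in X * `|_|](gtr0_norm d1) -normrM lambda2_bessel normrM normrN.
set y := 1 / 4 * _; rewrite -!mulrA ler_wpM2l//; have y0 : 0 <= y.
  by rewrite /y !mulr_ge0 ?sqnorm_ge0 ?sqr_ge0//; lra.
have c0 : 3 / 2 <= (n%:R + 4) / 2 :> R by lra.
have /andP[K0 K1] := bessel_log_bound c0 y0.
rewrite ger0_norm//; apply: le_trans K1 _.
have -> : 2 * ((n%:R + 4) / 2) - 1 = n%:R + 3 :> R by field.
rewrite ler_wpM2l ?addr_ge0//; apply: le_trans (HC _ (sqnorm_ge0 nu)).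
by rewrite -/y lerDr.
Qed.

Lemma bessel_mean_le_cst c y : 3 / 2 <= c -> 0 <= y ->
  [/\ 0 <= bessel_mean c y, bessel_mean c y <= 2 * c - 1 &
      y * bessel_mean c y <= 2 * c - 1].
Proof.
move=> c0 y0; have /andP[F0] := bessel_mean_bound c0 y0.
rewrite ler_pdivlMr; last lra.
rewrite mulrDr mulr1 (mulrC _ y) => F1.
by have := mulr_ge0 y0 F0; split; lra.
Qed.

(** The logarithm comes from [bessel_log] alone: y F and y F^2 are bounded.
    The condition n > 0 makes the parameter (n + 2) / 2 of the squared term
    at least 3/2, as the energy estimate requires. *)
Lemma lambda1_bound n (delta mu lam : R) (eta : R) :
  (0 < n)%N -> 0 < delta -> 0 < eta ->
  exists2 C, 0 <= C & forall nu : 'cV[R]_n,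
    `|lambda1 delta n%:R mu lam nu| <= C * (1 + sqnorm nu) `^ eta.
Proof.
move=> n0 d0 e0; have [C C0 HC] := ln_sqnorm_bound delta e0.
have d1 : 0 < delta ^+ 2 / 4 by rewrite divr_gt0 ?exprn_gt0.
have n1 : 1 <= n%:R :> R by rewrite ler1n.
pose A := `|mu| * (3 * (n%:R + 3)) + `|lam - mu| * (n%:R + 1) ^+ 2.
have A0 : 0 <= A.
  by rewrite addr_ge0// mulr_ge0 ?sqr_ge0//; lra.
exists ((delta ^+ 2 / 4)^-1 * (A * C)).
  by rewrite !mulr_ge0 ?invr_ge0 ?(ltW d1).
move=> nu; rewrite -(mulrA _^-1) -(ler_pM2l d1) mulVKf ?gt_eqF//.
rewrite -[X in X * `|_|](gtr0_norm d1) -normrM lambda1_bessel normrN.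
set y := 1 / 4 * _; have y0 : 0 <= y.
  by rewrite /y !mulr_ge0 ?sqnorm_ge0 ?sqr_ge0//; lra.
have c0 : 3 / 2 <= (n%:R + 4) / 2 :> R by lra.
have c1 : 3 / 2 <= (n%:R + 2) / 2 :> R by lra.
have /andP[K0 K1] := bessel_log_bound c0 y0.
have [F0 _ F1] := bessel_mean_le_cst c0 y0.
have [G0 G1 G2] := bessel_mean_le_cst c1 y0.
have := HC _ (sqnorm_ge0 nu); rewrite -/y => HCy.
have l0 : 0 <= ln (1 + y) by rewrite ln_ge0// lerDl.
apply: le_trans (_ : A * (1 + ln (1 + y)) <= _); last first.
  by rewrite -(mulrA A) ler_wpM2l.
move: (bessel_log _ _) K0 K1 (bessel_mean _ _) F0 F1 (bessel_mean _ _) G0 G1 G2.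
move=> L K0 K1 F F0 F1 G G0 G1 G2; clearbody y.
rewrite (le_trans (ler_normD _ _))// !normrM.
rewrite /A (mulrDl (`|mu| * _)) -!mulrA; apply: lerD; apply: ler_wpM2l => //.
  have yF := mulr_ge0 y0 F0; rewrite (ger0_norm (x := L + 2 * (y * F))).
    by move: l0 K1; set l := ln _ => l0 K1; nra.
  by apply: addr_ge0 => //; apply: mulr_ge0.
rewrite !ger0_norm//.
have yG : 0 <= y * G by rewrite mulr_ge0.
apply: le_trans (_ : (n%:R + 1) * (n%:R + 1) <= _).
  by rewrite mulrA ler_pM//; lra.
have n2 : 0 <= n%:R + 1 :> R by lra.
by rewrite mulrA ler_peMr ?mulr_ge0// lerDl.
Qed.

End Multipliers.
(** * Sums over finite subsets of the lattice *)
Section Lattice.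
Variable R : realType.

Lemma sum_inj_le (T U : finType) (h : T -> U) (w : U -> R) :
  injective h -> (forall u, 0 <= w u) -> \sum_(i : T) w (h i) <= \sum_u w u.
Proof.
move=> hi w0; rewrite -(big_imset w (in2W hi))/=.
by rewrite [leRHS](bigID (mem (h @: T)))/= lerDl sumr_ge0.
Qed.

(** Telescoping: 1 / (1 + i^2) <= 4 / ((i + 1) (i + 2)). *)
Lemma sum_inv_sqr_le N : \sum_(i < N) (1 + i%:R ^+ 2)^-1 <= 4 :> R.
Proof.
suff: \sum_(i < N) (1 + i%:R ^+ 2)^-1 <= 4 - 4 / N.+1%:R :> R.
  by move=> /le_trans; apply; rewrite gerBl divr_ge0.
elim: N => [|N IH]; first by rewrite big_ord0 divr1 subrr.
rewrite big_ord_recr/=; apply: le_trans (lerD IH (lexx _)) _.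
have x0 : 0 <= N%:R :> R by [].
rewrite -(nat1r N.+1) -(nat1r N); move: (N%:R) x0 => x x0.
have -> : 4 - 4 / (1 + (1 + x)) =
    4 - 4 / (1 + x) + 4 / ((1 + x) * (2 + x)).
  by field; rewrite !gt_eqF//; lra.
rewrite lerD2l ler_pdivlMr; last by rewrite mulr_gt0//; lra.
rewrite mulrC ler_pdivrMr; last by nra.
have : 0 <= (2 * x - 1) ^+ 2 by exact: sqr_ge0.
rewrite !expr2; nra.
Qed.

(** The family kappa enumerates a finite subset of Z^n.  It is embedded into a
    box of pairs (sign, absolute value); over the box the sum of products is a
    product of sums, each at most 4 + 4 for the two signs. *)
Lemma lattice_sum_le n (T : finType) (kappa : T -> 'cV[int]_n) :
  injective kappa ->
  \sum_(i : T) \prod_(j < n) (1 + (kappa i j 0)%:~R ^+ 2)^-1 <= 8 ^+ n :> R.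
Proof.
move=> inj; pose N := \max_(i : T) \max_(j < n) `|kappa i j 0%R|%N.
have kN i j : (`|kappa i j 0%R| < N.+1)%N.
  rewrite ltnS /N; apply: leq_trans (leq_bigmax i).
  exact: (leq_bigmax j).
pose h i := [ffun j : 'I_n =>
  (kappa i j 0 < 0, inord `|kappa i j 0%R|%N : 'I_N.+1)].
have hi : injective h.
  move=> a b /ffunP E; apply: inj; apply/matrixP => j l; rewrite ord1.
  have := E j; rewrite !ffunE => -[sg /(congr1 val)]/=.
  rewrite !inordK ?kN// => ab.
  by rewrite [LHS]intEsign [RHS]intEsign sg ab.
pose w (f : {ffun 'I_n -> bool * 'I_N.+1}) : R :=
  \prod_(j < n) (1 + (f j).2%:R ^+ 2)^-1.
have -> : \sum_(i : T) \prod_(j < n) (1 + (kappa i j 0)%:~R ^+ 2)^-1 =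
    \sum_i w (h i).
  apply: eq_bigr => i _; apply: eq_bigr => j _; rewrite ffunE/= inordK ?kN//.
  by rewrite natr_absz intr_norm real_normK// num_real.
apply: le_trans (sum_inj_le hi _) _.
  by move=> f; apply: prodr_ge0 => j _; rewrite invr_ge0 addr_ge0 ?sqr_ge0.
rewrite /w -(bigA_distr_bigA
  (fun _ (p : bool * 'I_N.+1) => (1 + p.2%:R ^+ 2)^-1)).
rewrite prodr_const card_ord lerXn2r ?nnegrE//.
  by apply: sumr_ge0 => p _; rewrite invr_ge0 addr_ge0 ?sqr_ge0.
rewrite -(pair_bigA _ (fun (_ : bool) (i : 'I_N.+1) => (1 + i%:R ^+ 2)^-1 : R)).
rewrite /= big_bool /=; have := sum_inv_sqr_le N.+1; lra.
Qed.

Lemma esum_fin_le (I : choiceType) (a : I -> R) (T : finType) (kappa : T -> I) :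
  injective kappa ->
  (\esum_(k in [set: I]) (a k)%:E < +oo)%E -> (forall k, 0 <= a k) ->
  \sum_(i : T) a (kappa i) <= fine (\esum_(k in [set: I]) (a k)%:E).
Proof.
move=> inj fin a0; rewrite -lee_fin fineK; last first.
  by rewrite ge0_fin_numE// esum_ge0// => k _; rewrite lee_fin.
apply: esum_ge; exists [set` map kappa (enum T)].
  by split => //; exact: finite_seq.
have u : uniq (map kappa (enum T)) by rewrite map_inj_uniq ?enum_uniq.
by rewrite -fsbig_seq// big_map big_enum/= sumEFin.
Qed.

(** Each factor satisfies 1 + k_j^2 <= 1 + |k|^2.  This is where decay of
    order n in 1 + |k|^2, that is s > n, is used. *)
Lemma exp_sqnorm_inv_le n (k : 'cV[int]_n) :
  ((1 + sqnorm (freq R k)) ^+ n)^-1 <= \prod_(j < n) (1 + (k j 0)%:~R ^+ 2)^-1.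
Proof.
have -> : ((1 + sqnorm (freq R k)) ^+ n)^-1 =
    \prod_(j < n) (1 + sqnorm (freq R k))^-1.
  by rewrite prodr_const card_ord exprVn.
apply: ler_prod => j _.
have kj : 0 <= (k j 0)%:~R ^+ 2 :> R by exact: sqr_ge0.
rewrite invr_ge0 addr_ge0 ?sqnorm_ge0//= lef_pV2 ?posrE ?ltr_wpDr ?sqnorm_ge0//.
rewrite lerD2l /sqnorm /dot (bigD1 j)//= mxE -expr2 lerDl sumr_ge0// => i _.
by rewrite -expr2 sqr_ge0.
Qed.

End Lattice.

(** * Unordered sums in C^n *)
Section RealSums.
#[local] Existing Instance totally_filter.
Variables (R : realType) (I : choiceType).
Implicit Types (r : I -> R) (A B : {fset I}).

Lemma partial_sum_le r A B : (forall i, 0 <= r i) -> (A `<=` B)%fset ->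
  partial_sum r A <= partial_sum r B.
Proof.
move=> r0 AB.
have hi : injective (fincl AB).
  by move=> i j /(congr1 val)/= ij; exact: val_inj.
exact: (sum_inj_le (w := fun i : B => r (val i)) hi (fun i => r0 _)).
Qed.

Lemma ge0_sum_cvg r (C : R) : (forall i, 0 <= r i) ->
  (forall A, partial_sum r A <= C) -> cvg (partial_sum r @ totally).
Proof.
move=> r0 rC; apply/cvg_ex; exists (sup (range (partial_sum r))).
have hs : has_sup (range (partial_sum r)).
  split; first by exists (partial_sum r fset0); exists fset0.
  by exists C => _ [A _ <-].
apply/cvgrPdist_lt => e e0.
have [_ [A _ <-] Ae] := sup_adherent e0 hs.
exists A => // B /= AB; rewrite ger0_norm.
  rewrite ltrBlDr -ltrBlDl (lt_le_trans Ae)//; exact: partial_sum_le.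
by rewrite subr_ge0; apply: ub_le_sup; [exact: hs.2|exists B].
Qed.

Lemma abs_sum_cvg r (C : R) :
  (forall A, partial_sum (fun i => `|r i|) A <= C) ->
  cvg (partial_sum r @ totally).
Proof.
move=> rC.
have c1 : cvg (partial_sum (fun i => `|r i|) @ totally).
  exact: ge0_sum_cvg rC.
have c2 : cvg (partial_sum (fun i => `|r i| + r i) @ totally).
  apply: (@ge0_sum_cvg _ (C + C)) => [i|A].
    by rewrite -lerBlDr sub0r -normrN ler_norm.
  rewrite /partial_sum big_split/= lerD ?rC//.
  by apply: le_trans (rC A); apply: ler_sum => i _; exact: ler_norm.
have -> : partial_sum r =
    partial_sum (fun i => `|r i| + r i) - partial_sum (fun i => `|r i|).
  apply/funext => A; rewrite !fctE /partial_sum -sumrB.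
  by apply: eq_bigr => i _; rewrite addrAC subrr add0r.
exact: is_cvgB.
Qed.

End RealSums.

Lemma cvg_sum0 (R : realType) (T : Type) (F : set_system T) (J : finType)
    (f : J -> T -> R) :
  Filter F -> (forall j, f j x @[x --> F] --> (0 : R)) ->
  \sum_j f j x @[x --> F] --> (0 : R).
Proof.
move=> FF fj.
have := @cvg_big R J +%R 0 xpredT (fun z => @add_continuous _ z) T F
  (index_enum J) f (fun=> 0) FF (fun j _ => fj j).
by rewrite [X in _ --> X]big1.
Qed.

Lemma cvg_dist0 (R : realType) (T : Type) (F : set_system T) (f : T -> R) l :
  Filter F -> f @ F --> l -> `|l - f x| @[x --> F] --> (0 : R).
Proof.
move=> FF fl; have := cvg_norm (cvgB (cvg_cst l) fl).
by rewrite subrr normr0; exact.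
Qed.

Section VectorSums.
#[local] Existing Instance totally_filter.
Local Open Scope complex_scope.
Variables (R : realType) (n : nat) (I : choiceType).
Implicit Types (u v : Cvec R n) (a : I -> Cvec R n).
Local Notation Re := complex.Re.
Local Notation Im := complex.Im.

(** A real-valued norm on C^n; the norm of the topology takes its values in the
    complex numbers. *)
Definition norm1 (v : Cvec R n) : R :=
  \sum_(j < n) (`|Re (v j 0)| + `|Im (v j 0)|).

Lemma norm1_ge0 v : 0 <= norm1 v.
Proof. by apply: sumr_ge0 => j _; rewrite addr_ge0. Qed.

Lemma norm1D u v : norm1 (u + v) <= norm1 u + norm1 v.
Proof.
rewrite /norm1 -big_split/=; apply: ler_sum => j _; rewrite mxE !raddfD/=.
by rewrite addrACA lerD ?ler_normD.
Qed.

Lemma norm1Z (c : R) v : norm1 (c%:C *: v) = `|c| * norm1 v.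
Proof.
rewrite /norm1 mulr_sumr; apply: eq_bigr => j _; rewrite mxE.
by case: (v j 0) => x y /=; rewrite !mul0r subr0 addr0 !normrM mulrDr.
Qed.

Lemma norm1_zero : norm1 0 = 0.
Proof. by rewrite -(scale0r (0 : Cvec R n)) (norm1Z 0) normr0 mul0r. Qed.

Lemma norm1_sum (J : finType) (F : J -> Cvec R n) :
  norm1 (\sum_i F i) <= \sum_i norm1 (F i).
Proof.
elim/big_ind2 : _ => [|x a y b xa yb|//]; first by rewrite norm1_zero.
by rewrite (le_trans (norm1D _ _))// lerD.
Qed.

Lemma normr_le_norm1 v : `|v| <= (norm1 v)%:C.
Proof.
have -> : `|v| = mx_norm v by [].
have [->|/mx_norm_neq0[[i k] ->]/=] := eqVneq (mx_norm v) 0.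
  by rewrite ler0c norm1_ge0.
rewrite (ord1 k) /norm1 (bigD1 i)//=.
have -> : `|v i 0| = (Num.sqrt (Re (v i 0) ^+ 2 + Im (v i 0) ^+ 2))%:C.
  exact: normc_def.
rewrite lecR; apply: le_trans (_ : `|Re (v i 0)| + `|Im (v i 0)| <= _).
  rewrite -[leRHS]ger0_norm ?addr_ge0// -sqrtr_sqr ler_wsqrtr// sqrrD.
  by rewrite !real_normK ?num_real// addrAC lerDl mulrn_wge0 ?mulr_ge0.
by rewrite lerDl sumr_ge0// => k' _; rewrite addr_ge0.
Qed.

Lemma cvg_norm1 (T : Type) (F : set_system T) (f : T -> Cvec R n) l :
  Filter F -> norm1 (l - f x) @[x --> F] --> (0 : R) -> f @ F --> l.
Proof.
move=> FF /cvgrPdist_lt H; apply/cvgrPdist_lt => -[e e'].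
rewrite ltcE/= => /andP[/eqP -> e0].
have := H e e0; apply: filterS => x; rewrite sub0r normrN => Hx.
apply: le_lt_trans (normr_le_norm1 _) _; rewrite ltcR.
by rewrite (le_lt_trans _ Hx)// ler_norm.
Qed.

Definition has_sum a l :=
  norm1 (l - partial_sum a A) @[A --> totally] --> (0 : R).

Lemma has_sum_cvg a l : has_sum a l -> sums_converge a /\ sum a = l.
Proof.
move=> /cvg_norm1 H; split; first by apply/cvg_ex; exists l.
exact: cvg_lim H.
Qed.

(** Absolute convergence: the real and imaginary parts of each coordinate are
    differences of nonnegative families with bounded partial sums. *)
Lemma norm1_sums_converge a (C : R) :
  (forall A, partial_sum (fun i => norm1 (a i)) A <= C) ->
  sums_converge a /\ has_sum a (sum a).
Proof.
move=> aC; suff [l al] : exists l, has_sum a l.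
  by have [ca E] := has_sum_cvg al; rewrite E.
have cre j : cvg (partial_sum (fun i => Re (a i j 0)) @ totally).
  apply: (@abs_sum_cvg _ _ _ C) => A; apply: le_trans (aC A).
  apply: ler_sum => i _; rewrite /norm1 (bigD1 j)//= -addrA lerDl addr_ge0//.
  by apply: sumr_ge0 => k _; rewrite addr_ge0.
have cim j : cvg (partial_sum (fun i => Im (a i j 0)) @ totally).
  apply: (@abs_sum_cvg _ _ _ C) => A; apply: le_trans (aC A).
  apply: ler_sum => i _; rewrite /norm1 (bigD1 j)//= addrAC lerDr addr_ge0//.
  by apply: sumr_ge0 => k _; rewrite addr_ge0.
pose lre j := lim (partial_sum (fun i => Re (a i j 0)) @ totally).
pose lim_ j := lim (partial_sum (fun i => Im (a i j 0)) @ totally).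
exists (\col_j (lre j +i* lim_ j)); rewrite /has_sum.
have -> : (fun A => norm1 (\col_j (lre j +i* lim_ j) - partial_sum a A)) =
  (fun A => \sum_(j < n)
   (`|lre j - partial_sum (fun i => Re (a i j 0)) A| +
    `|lim_ j - partial_sum (fun i => Im (a i j 0)) A|)).
  apply/funext => A; apply: eq_bigr => j _.
  by rewrite !mxE !raddfB /= /partial_sum summxE !raddf_sum.
apply: cvg_sum0 => j.
have FF : Filter (@totally I) by exact: totally_filter.
have := cvgD (cvg_dist0 FF (cre j)) (cvg_dist0 FF (cim j)).
by rewrite addr0; exact.
Qed.

(** The epsilon form, convenient for algebra on sums. *)
Lemma has_sumP a l : has_sum a l <->
  forall e : R, 0 < e ->
    \forall A \near @totally I, norm1 (l - partial_sum a A) < e.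
Proof.
have FF : Filter (@totally I) by exact: totally_filter.
split=> [/cvgrPdist_lt H e e0|H]; last apply/cvgrPdist_lt => e e0.
  apply: filterS (H e e0) => A; rewrite sub0r normrN.
  by rewrite ger0_norm// norm1_ge0.
apply: filterS (H e e0) => A; rewrite sub0r normrN.
by rewrite ger0_norm// norm1_ge0.
Qed.

Lemma has_sumD a b l m : has_sum a l -> has_sum b m ->
  has_sum (fun i => a i + b i) (l + m).
Proof.
have FF : Filter (@totally I) by exact: totally_filter.
move=> /has_sumP al /has_sumP bm; apply/has_sumP => e e0.
have e2 : 0 < e / 2 by rewrite divr_gt0.
apply: filterS2 (al _ e2) (bm _ e2) => A la mb.
have -> : partial_sum (fun i => a i + b i) A =
    partial_sum a A + partial_sum b A.
  by rewrite /partial_sum big_split.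
rewrite opprD addrACA (le_lt_trans (norm1D _ _))//.
by rewrite [ltRHS](splitr e) ltrD.
Qed.

Lemma has_sumZ c a l :
  has_sum a l -> has_sum (fun i => c%:C *: a i) (c%:C *: l).
Proof.
have FF : Filter (@totally I) by exact: totally_filter.
move=> /has_sumP al; apply/has_sumP => e e0.
have c0 : 0 < `|c| + 1 by rewrite ltr_wpDl.
apply: filterS (al (e / (`|c| + 1)) _) => [A|]; last by rewrite divr_gt0.
have -> : partial_sum (fun i => c%:C *: a i) A = c%:C *: partial_sum a A.
  by rewrite /partial_sum -scaler_sumr.
rewrite -scalerBr norm1Z ltr_pdivlMr// => H.
by apply: le_lt_trans H; rewrite mulrC ler_wpM2l ?norm1_ge0// lerDl.
Qed.

Lemma has_sum_le a l (C : R) : has_sum a l ->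
  (forall A, partial_sum (fun i => norm1 (a i)) A <= C) -> norm1 l <= C.
Proof.
move=> /has_sumP al aC; apply/ler_addgt0Pr => e e0.
have [A _ /(_ A (fsubset_refl A)) H] := al e e0.
rewrite -[l](subrK (partial_sum a A)) (le_trans (norm1D _ _))//.
rewrite addrC; apply: lerD; last exact: ltW.
by apply: le_trans (aC A); exact: norm1_sum.
Qed.

End VectorSums.

Section TermwiseDerivative.
#[local] Existing Instance totally_filter.
Local Open Scope complex_scope.
Variables (R : realType) (n : nat) (I : choiceType).

(** Here [a i t k] is meant as the i-th derivative at t of the k-th term, and
    [m i k] bounds both its size and, two orders higher, the error of its
    linear approximation.  Taking sums in the second estimate bounds the error
    of the difference quotient of the sum by |h| B_(i + 2).  The factor 1 + t
    accounts for sin(a t) / a, which is not bounded uniformly in a and t. *)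
Lemma termwise_derivative (a : nat -> R -> I -> Cvec R n) (m : nat -> I -> R)
    (B : nat -> R) :
  (forall i A, partial_sum (m i) A <= B i) ->
  (forall i t k, 0 <= t -> norm1 (a i t k) <= (1 + t) * m i k) ->
  (forall i t h k,
     norm1 (a i (t + h) k - a i t k - h%:C *: a i.+1 t k)
     <= h ^+ 2 * m i.+2 k) ->
  forall i t, 0 <= t ->
    sums_converge (a i t) /\
    derivative_within [set t | 0 <= t] (fun s => sum (a i s)) t
      (sum (a i.+1 t)).
Proof.
move=> mB am ta.
have conv i t : 0 <= t ->
    sums_converge (a i t) /\ has_sum (a i t) (sum (a i t)).
  move=> t0; apply: (@norm1_sums_converge _ _ _ _ ((1 + t) * B i)) => A.
  apply: le_trans (_ : partial_sum (fun k => (1 + t) * m i k) A <= _).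
    by apply: ler_sum => k _; exact: am.
  rewrite /partial_sum -mulr_sumr ler_wpM2l ?addr_ge0//; exact: mB.
move=> i t t0; split; first by have [] := conv i t t0.
apply: cvg_norm1.
have B0 : 0 <= B i.+2 by have := mB i.+2 fset0; rewrite /partial_sum big_fset0.
have rem h : 0 <= t + h -> h != 0 ->
  norm1 (sum (a i.+1 t) - (h^-1)%:C *: (sum (a i (t + h)) - sum (a i t)))
    <= `|h| * B i.+2.
  move=> th h0.
  have [_ s0] := conv i t t0; have [_ s1] := conv i (t + h) th.
  have [_ s2] := conv i.+1 t t0.
  have := has_sumD (has_sumD s1 (has_sumZ (-1) s0)) (has_sumZ (- h) s2).
  move=> /has_sum_le => /(_ (h ^+ 2 * B i.+2)).
  rewrite -(ler_pM2l (x := `|h^-1|)) ?normr_gt0 ?invr_eq0//.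
  rewrite -[X in X * norm1 _]normrN -norm1Z.
  have -> : `|h^-1| * (h ^+ 2 * B i.+2) = `|h| * B i.+2.
    rewrite -real_normK ?num_real// normfV expr2 !mulrA.
    by rewrite mulVf ?normr_eq0// mul1r.
  set L := _ *: _; set L' := sum (a i.+1 t) - _.
  have -> : L = L'.
    have hh : (h^-1)%:C * h%:C = 1 by rewrite -rmorphM/= mulVf.
    rewrite /L /L' !rmorphN rmorph1 scaleN1r !scaleNr scalerDr opprD.
    by rewrite scalerN opprK scalerA hh scale1r addrC.
  apply=> A.
  apply: le_trans (_ : partial_sum (fun k => h ^+ 2 * m i.+2 k) A <= _).
    apply: ler_sum => k _; rewrite rmorphN rmorph1 scaleN1r rmorphN scaleNr.
    exact: ta.
  rewrite /partial_sum -mulr_sumr ler_wpM2l ?sqr_ge0//; exact: mB.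
apply/cvgrPdist_lt => e e0; rewrite near_withinE.
have B1 : 0 < B i.+2 + 1 by rewrite ltr_wpDl.
have eB : 0 < e / (B i.+2 + 1) by rewrite divr_gt0.
near=> h => /= th.
rewrite sub0r normrN ger0_norm ?norm1_ge0//.
apply: le_lt_trans (rem h th _) _; first by near: h; exact: nbhs_dnbhs_neq.
apply: le_lt_trans (_ : `|h| * (B i.+2 + 1) < e).
  by rewrite ler_wpM2l// lerDl.
by rewrite -ltr_pdivlMr//; near: h; exact: dnbhs0_lt.
Unshelve. all: by end_near. Qed.

End TermwiseDerivative.

(** * Time derivatives of the modes *)
Section Oscillation.
Variable R : realType.
Implicit Types (x y a t h phi : R).

Lemma sin_le_norm y : `|sin y| <= `|y|.
Proof.
wlog y0 : y / 0 <= y.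
  move=> H; have [/H//|/ltW y0] := leP 0 y.
  by rewrite -normrN -sinN -(normrN y) H// oppr_ge0.
have [|c _] := @MVT_segment _ sin cos 0 y y0 (fun x _ => is_derive_sin x).
  by apply: continuous_subspaceT => x; exact: continuous_sin.
rewrite sin0 !subr0 => ->; rewrite normrM ler_piMl// ler_norml cos_geN1.
exact: cos_le1.
Qed.

Lemma cos_sub1 y : cos y - 1 = - 2 * sin (y / 2) ^+ 2.
Proof. by rewrite {1}(splitr y) cosD -!expr2 cos2sin2; ring. Qed.

Lemma cos_sub1_le_norm y : `|cos y - 1| <= `|y|.
Proof.
rewrite cos_sub1 normrM normrN normr_nat normrX.
have s1 : `|sin (y / 2)| <= 1 by rewrite ler_norml sin_geN1 sin_le1.
have s2 := sin_le_norm (y / 2).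
have E : `|y| = 2 * `|y / 2| by rewrite normrM (ger0_norm (x := 2^-1))//; field.
rewrite E ler_pM2l// expr2 -[leRHS]mul1r; apply: ler_pM => //.
Qed.

(** The mean value theorem with |cos c - 1| <= |c|. *)
Lemma sin_sub_le_sqr y : `|sin y - y| <= y ^+ 2.
Proof.
wlog y0 : y / 0 <= y.
  move=> H; have [/H//|/ltW y0] := leP 0 y.
  by rewrite -normrN opprD -sinN -(sqrrN y) H// oppr_ge0.
have D x : is_derive x 1 (sin - id) (cos x - 1) by exact: is_deriveB.
have [|c] := @MVT_segment _ (sin - id) (fun x => cos x - 1) 0 y y0
  (fun x _ => D x).
  apply: continuous_subspaceT => x.
  by apply/differentiable_continuous/derivable1_diffP; have [] := D x.
rewrite in_itv/= => /andP[c0 cy]; rewrite !fctE sin0 !subr0 => ->.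
rewrite normrM expr2 (ger0_norm y0) ler_wpM2r//.
by rewrite (le_trans (cos_sub1_le_norm c))// ger0_norm.
Qed.

Lemma cos_sub1_le_sqr y : `|cos y - 1| <= y ^+ 2.
Proof.
rewrite cos_sub1 normrM normrN normr_nat normrX -(real_normK (num_real y)).
have s2 := sin_le_norm (y / 2).
have E : `|y| = 2 * `|y / 2| by rewrite normrM (ger0_norm (x := 2^-1))//; field.
have : `|sin (y / 2)| ^+ 2 <= `|y / 2| ^+ 2 by rewrite lerXn2r ?nnegrE.
by rewrite E exprMn; have := sqr_ge0 `|y / 2|; lra.
Qed.

Lemma cos_taylor_le x y : `|cos (x + y) - cos x + y * sin x| <= 2 * y ^+ 2.
Proof.
have -> : cos (x + y) - cos x + y * sin x =
   cos x * (cos y - 1) - sin x * (sin y - y) by rewrite cosD; ring.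
rewrite (le_trans (ler_normB _ _))// !normrM mulr2n mulrDl mul1r lerD//.
  rewrite -[leRHS]mul1r ler_pM ?cos_sub1_le_sqr//.
  by rewrite ler_norml cos_geN1 cos_le1.
rewrite -[leRHS]mul1r ler_pM ?sin_sub_le_sqr//.
by rewrite ler_norml sin_geN1 sin_le1.
Qed.

(** The i-th derivative of t |-> cos (a t + phi).  The phase phi = - pi / 2
    gives the derivatives of sin (a t). *)
Definition osc phi a i t : R := a ^+ i * cos (a * t + (i%:R * (pi / 2) + phi)).

Lemma osc_le phi a i t : 0 <= a -> `|osc phi a i t| <= a ^+ i.
Proof.
move=> a0; rewrite normrM normrX (ger0_norm a0) ler_piMr ?exprn_ge0//.
by rewrite ler_norml cos_geN1 cos_le1.
Qed.

Lemma osc_taylor phi a i t h : 0 <= a ->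
  `|osc phi a i (t + h) - osc phi a i t - h * osc phi a i.+1 t| <=
  2 * h ^+ 2 * a ^+ i.+2.
Proof.
move=> a0; rewrite /osc; set q := a * t + (i%:R * (pi / 2) + phi).
have -> : a * (t + h) + (i%:R * (pi / 2) + phi) = q + a * h by rewrite /q; ring.
have -> : a * t + (i.+1%:R * (pi / 2) + phi) = q + pi / 2.
  by rewrite /q -nat1r; ring.
have -> : cos (q + pi / 2) = - sin q.
  by rewrite cosD cos_pihalf sin_pihalf; ring.
have -> : a ^+ i * cos (q + a * h) - a ^+ i * cos q
    - h * (a ^+ i.+1 * - sin q) =
  a ^+ i * (cos (q + a * h) - cos q + (a * h) * sin q) by rewrite exprS; ring.
rewrite normrM normrX (ger0_norm a0).
have -> : 2 * h ^+ 2 * a ^+ i.+2 = a ^+ i * (2 * (a * h) ^+ 2).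
  by rewrite !exprS expr0; ring.
by rewrite ler_wpM2l ?exprn_ge0// cos_taylor_le.
Qed.

(** The bound stays finite as a tends to 0: for i = 0 it comes from
    |sin (a t)| <= a t, and for i > 0 the division removes one factor a. *)
Lemma osc_div_le a i t : 0 < a -> 0 <= t ->
  `|osc (- (pi / 2)) a i t / a| <= (1 + t) * (1 + a) ^+ i.
Proof.
move=> a0 t0; have a1 : 1 <= 1 + a by rewrite lerDl ltW.
case: i => [|i].
  have -> : osc (- (pi / 2)) a 0 t = sin (a * t).
    rewrite /osc expr0 mul0r add0r cosD cosN sinN cos_pihalf sin_pihalf.
    ring.
  rewrite expr0 mulr1.
  rewrite normrM normfV (gtr0_norm a0) ler_pdivrMr//.
  rewrite (le_trans (sin_le_norm _))// ger0_norm; last first.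
    by rewrite mulr_ge0// ltW.
  by rewrite mulrC ler_pM2r//; lra.
rewrite normrM normfV (gtr0_norm a0) ler_pdivrMr//.
apply: le_trans (osc_le _ _ _ (ltW a0)) _; rewrite exprS mulrC ler_pM2r//.
rewrite -[leLHS]mul1r; apply: ler_pM => //; [|lra|].
  by rewrite exprn_ge0// ltW.
apply: le_trans (_ : (1 + a) ^+ i <= _); last by rewrite ler_eXn2l// ltr_pwDr.
by rewrite lerXn2r ?nnegrE; lra.
Qed.

Lemma osc_div_taylor a i t h : 0 < a ->
  `|(osc (- (pi / 2)) a i (t + h) / a) - (osc (- (pi / 2)) a i t / a)
     - h * (osc (- (pi / 2)) a i.+1 t / a)| <= 2 * h ^+ 2 * a ^+ i.+1.
Proof.
move=> a0; rewrite mulrA -!mulrBl normrM normfV (gtr0_norm a0) ler_pdivrMr//.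
by rewrite -[leRHS]mulrA -exprSr; exact/osc_taylor/ltW.
Qed.

End Oscillation.

(** * Fourier modes of the solution *)
Section Modes.
Local Open Scope complex_scope.
Variables (R : realType) (n : nat).
Implicit Types (v : 'cV[R]_n) (w : 'cV[R[i]]_n) (p q : R).
Local Notation Re := complex.Re.
Local Notation Im := complex.Im.

Lemma norm1_expi theta w : norm1 (expi theta *: w) <= 2 * norm1 w.
Proof.
rewrite /norm1 mulr_sumr; apply: ler_sum => j _; rewrite mxE.
case: (w j 0) => x y /=.
have c1 : `|cos theta| <= 1 by rewrite ler_norml cos_geN1 cos_le1.
have s1 : `|sin theta| <= 1 by rewrite ler_norml sin_geN1 sin_le1.
rewrite mulr2n mulrDl mul1r lerD//.
  rewrite (le_trans (ler_normB _ _))// !normrM lerD// ler_piMl//.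
by rewrite (le_trans (ler_normD _ _))// !normrM addrC lerD// ler_piMl//.
Qed.

Lemma norm1_mulmx (M : 'M[R]_n) c w : (forall i j, `|M i j| <= c) ->
  norm1 (real_mx M *m w) <= n%:R * c * norm1 w.
Proof.
move=> Mc.
have H i : `|Re ((real_mx M *m w) i 0)| + `|Im ((real_mx M *m w) i 0)|
    <= c * norm1 w.
  rewrite mxE !raddf_sum/= /norm1 mulr_sumr.
  rewrite (le_trans (lerD (ler_norm_sum _ _ _) (ler_norm_sum _ _ _)))//.
  rewrite -big_split/=; apply: ler_sum => j _; rewrite mxE.
  case: (w j 0) => x y /=; rewrite !mul0r subr0 addr0 !normrM -mulrDr.
  by rewrite ler_wpM2r ?addr_ge0.
rewrite {1}/norm1 -mulrA; apply: le_trans (ler_sum _ (fun i _ => H i)) _.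
by rewrite sumr_const card_ord mulr_natl.
Qed.

Lemma eigen_mxE v p q i j : eigen_mx v p q i j =
  (p - q) * ((sqnorm v)^-1 * (v i 0 * v j 0)) + q * (i == j)%:R.
Proof.
by rewrite /eigen_mx !mxE big_ord1 !mxE; ring.
Qed.

(** The entries v_i v_j / |v|^2 of the projection onto v are at most 1. *)
Lemma eigen_mx_le v p q c i j : v != 0 -> `|p| <= c -> `|q| <= c ->
  `|eigen_mx v p q i j| <= 3 * c.
Proof.
move=> v0 pc qc; have s0 := sqnorm_gt0 v0.
have vs l : `|v l 0| ^+ 2 <= sqnorm v.
  rewrite real_normK ?num_real// /sqnorm /dot (bigD1 l)//= expr2 lerDl.
  by rewrite sumr_ge0// => l' _; rewrite -expr2 sqr_ge0.
have P1 : `|(sqnorm v)^-1 * (v i 0 * v j 0)| <= 1.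
  rewrite normrM normfV (gtr0_norm s0) mulrC ler_pdivrMr// mul1r normrM.
  have := vs i; have := vs j; have := sqr_ge0 (`|v i 0| - `|v j 0|); lra.
have d1 : `|(i == j)%:R : R| <= 1 by case: (i == j); rewrite ?normr1 ?normr0.
rewrite eigen_mxE (le_trans (ler_normD _ _))//.
rewrite [X in X + _]normrM [X in _ + X]normrM.
have -> : 3 * c = (c + c) * 1 + c * 1 by ring.
apply: lerD; apply: ler_pM => //.
by rewrite (le_trans (ler_normB _ _))// lerD.
Qed.

(** The i-th time derivative of the mode of frequency v, where a1 and a2 are
    the square roots of the opposites of the eigenvalues and theta is the
    phase of the exponential in x. *)
Definition mode v (a1 a2 theta : R) (fk gk : 'cV[R[i]]_n) (i : nat) (t : R)
    : Cvec R n :=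
  expi theta *:
    (real_mx (eigen_mx v (osc 0 a1 i t) (osc 0 a2 i t)) *m fk
     + real_mx (eigen_mx v (osc (- (pi / 2)) a1 i t / a1)
                           (osc (- (pi / 2)) a2 i t / a2)) *m gk).

(** The constant 6 is 2 for the multiplication by a unit complex number, which
    is not an isometry of [norm1], times 3 for the entries of the
    matrices. *)
Lemma norm1_eigen_pair v theta (p1 p2 q1 q2 c : R) (fk gk : 'cV[R[i]]_n) :
  v != 0 -> `|p1| <= c -> `|p2| <= c -> `|q1| <= c -> `|q2| <= c ->
  norm1 (expi theta *: (real_mx (eigen_mx v p1 p2) *m fk
          + real_mx (eigen_mx v q1 q2) *m gk))
  <= c * (6 * n%:R * (norm1 fk + norm1 gk)).
Proof.
move=> v0 p1c p2c q1c q2c; rewrite (le_trans (norm1_expi _ _))//.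
have -> : c * (6 * n%:R * (norm1 fk + norm1 gk)) =
  2 * (n%:R * (3 * c) * norm1 fk + n%:R * (3 * c) * norm1 gk) by ring.
rewrite ler_pM2l// (le_trans (norm1D _ _))// lerD//.
  by apply: norm1_mulmx => i j; exact: eigen_mx_le.
by apply: norm1_mulmx => i j; exact: eigen_mx_le.
Qed.

Lemma osc_le_expn (phi a b : R) i t : 0 <= a -> a <= b ->
  `|osc phi a i t| <= (1 + b) ^+ i.
Proof.
move=> a0 ab; apply: le_trans (osc_le phi i t a0) _.
by rewrite lerXn2r ?nnegrE; lra.
Qed.

(** The constant is 12, twice that of [norm1_eigen_pair], so that the same
    majorant serves the Taylor estimate below, which has a factor 2. *)
Lemma mode_le v (a1 a2 theta : R) (fk gk : 'cV[R[i]]_n) i t :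
  v != 0 -> 0 < a1 -> 0 < a2 -> 0 <= t ->
  norm1 (mode v a1 a2 theta fk gk i t) <=
  (1 + t) * ((1 + (a1 + a2)) ^+ i * (12 * n%:R * (norm1 fk + norm1 gk))).
Proof.
move=> v0 a10 a20 t0.
have b0 : 0 <= (1 + (a1 + a2)) ^+ i by rewrite exprn_ge0//; lra.
have N0 : 0 <= 6 * n%:R * (norm1 fk + norm1 gk).
  by rewrite mulr_ge0// addr_ge0// norm1_ge0.
apply: le_trans (_ : (1 + t) * (1 + (a1 + a2)) ^+ i *
    (6 * n%:R * (norm1 fk + norm1 gk)) <= _); last first.
  rewrite -mulrA ler_wpM2l ?addr_ge0// ler_wpM2l//; lra.
have le1 p : 0 <= p -> p <= (1 + (a1 + a2)) ^+ i ->
    p <= (1 + t) * (1 + (a1 + a2)) ^+ i.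
  by move=> p0 /le_trans; apply; rewrite ler_peMl// lerDl.
have ge a : 0 < a -> a <= a1 + a2 ->
    (1 + t) * (1 + a) ^+ i <= (1 + t) * (1 + (a1 + a2)) ^+ i.
  by move=> a0 aa; rewrite ler_wpM2l ?addr_ge0// lerXn2r ?nnegrE; lra.
apply: norm1_eigen_pair => //.
- by apply: le1 => //; apply: osc_le_expn; lra.
- by apply: le1 => //; apply: osc_le_expn; lra.
- by apply: le_trans (osc_div_le i a10 t0) (ge _ a10 _); lra.
- by apply: le_trans (osc_div_le i a20 t0) (ge _ a20 _); lra.
Qed.

Lemma real_mxB (M N : 'M[R]_n) : real_mx (M - N) = real_mx M - real_mx N.
Proof. exact: map_mxB. Qed.

Lemma real_mxZ (c : R) (M : 'M[R]_n) : real_mx (c *: M) = c%:C *: real_mx M.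
Proof. exact: map_mxZ. Qed.

Lemma eigen_mxB v p q p' q' :
  eigen_mx v (p - p') (q - q') = eigen_mx v p q - eigen_mx v p' q'.
Proof. by apply/matrixP => i j; rewrite !mxE; ring. Qed.

Lemma eigen_mxZ v c p q : eigen_mx v (c * p) (c * q) = c *: eigen_mx v p q.
Proof. by apply/matrixP => i j; rewrite !mxE; ring. Qed.

Lemma sub_sum_sum (V : zmodType) (a b c d e f : V) :
  a + b - (c + d) - (e + f) = (a - c - e) + (b - d - f).
Proof. by rewrite opprD (addrACA a) opprD (addrACA (a - c)). Qed.

Lemma mode_taylor v (a1 a2 theta : R) (fk gk : 'cV[R[i]]_n) i t h :
  v != 0 -> 0 < a1 -> 0 < a2 ->
  norm1 (mode v a1 a2 theta fk gk i (t + h) - mode v a1 a2 theta fk gk i t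
         - h%:C *: mode v a1 a2 theta fk gk i.+1 t) <=
  h ^+ 2 * ((1 + (a1 + a2)) ^+ i.+2 * (12 * n%:R * (norm1 fk + norm1 gk))).
Proof.
move=> v0 a10 a20.
pose rem phi a := osc phi a i (t + h) - osc phi a i t - h * osc phi a i.+1 t.
pose remd a := osc (- (pi / 2)) a i (t + h) / a - osc (- (pi / 2)) a i t / a
  - h * (osc (- (pi / 2)) a i.+1 t / a).
have -> : mode v a1 a2 theta fk gk i (t + h) - mode v a1 a2 theta fk gk i t
         - h%:C *: mode v a1 a2 theta fk gk i.+1 t =
  expi theta *: (real_mx (eigen_mx v (rem 0 a1) (rem 0 a2)) *m fk
     + real_mx (eigen_mx v (remd a1) (remd a2)) *m gk).
  rewrite /mode /rem /remd !eigen_mxB !eigen_mxZ !real_mxB !real_mxZ.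
  rewrite scalerA (mulrC h%:C) -scalerA -!scalerBr; congr (_ *: _).
  rewrite !mulmxBl -!scalemxAl scalerDr.
  by rewrite sub_sum_sum.
have remD phi a : 0 < a -> a <= a1 + a2 ->
    `|rem phi a| <= 2 * h ^+ 2 * (1 + (a1 + a2)) ^+ i.+2.
  move=> a0 aa; apply: le_trans (osc_taylor phi i t h (ltW a0)) _.
  apply: ler_wpM2l; first by rewrite mulr_ge0 ?sqr_ge0.
  by rewrite lerXn2r ?nnegrE; lra.
have remdD a : 0 < a -> a <= a1 + a2 ->
    `|remd a| <= 2 * h ^+ 2 * (1 + (a1 + a2)) ^+ i.+2.
  move=> a0 aa; apply: le_trans (osc_div_taylor i t h a0) _.
  apply: ler_wpM2l; first by rewrite mulr_ge0 ?sqr_ge0.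
  apply: le_trans (_ : (1 + (a1 + a2)) ^+ i.+1 <= _).
    by rewrite lerXn2r ?nnegrE; lra.
  by rewrite ler_eXn2l//; lra.
have -> : h ^+ 2 * ((1 + (a1 + a2)) ^+ i.+2 *
    (12 * n%:R * (norm1 fk + norm1 gk))) =
  2 * h ^+ 2 * (1 + (a1 + a2)) ^+ i.+2 *
    (6 * n%:R * (norm1 fk + norm1 gk)) by ring.
by apply: norm1_eigen_pair => //; (apply: remD || apply: remdD); lra.
Qed.

End Modes.

(** * The majorant given by Sobolev regularity *)
Section Majorant.
Local Open Scope complex_scope.
Variables (R : realType) (n : nat).
Local Notation Re := complex.Re.
Local Notation Im := complex.Im.

(** Young's inequality with weight W, coordinate by coordinate. *)
Lemma norm1_weighted (z : 'cV[R[i]]_n) (c W : R) : 0 < W ->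
  c * norm1 z <= W * csqnorm z + n%:R * (c ^+ 2 / W).
Proof.
move=> W0; have -> : n%:R * (c ^+ 2 / W) = \sum_(j < n) c ^+ 2 / W.
  by rewrite sumr_const card_ord mulr_natl.
rewrite /norm1 /csqnorm !mulr_sumr -big_split/=; apply: ler_sum => j _.
case: (z j 0) => x y /=; rewrite sqr_sqrtr ?addr_ge0 ?sqr_ge0//.
rewrite -(ler_pM2l W0).
have -> : W * (W * (x ^+ 2 + y ^+ 2) + c ^+ 2 / W) =
  W * (W * (x ^+ 2 + y ^+ 2)) + c ^+ 2 by field; rewrite gt_eqF.
rewrite -(real_normK (num_real x)) -(real_normK (num_real y)).
have := sqr_ge0 (2 * (W * `|x|) - c); have := sqr_ge0 (2 * (W * `|y|) - c).
have := sqr_ge0 c; rewrite !expr2; lra.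
Qed.

Variables (delta mu lam : R).

Definition freq_sum (k : 'cV[int]_n) : R :=
  Num.sqrt (- lambda1 delta n%:R mu lam (freq R k)) +
  Num.sqrt (- lambda2 delta n%:R mu (freq R k)).

Lemma sqrt_le1D (x : R) : Num.sqrt x <= 1 + `|x|.
Proof.
rewrite -[leRHS]ger0_norm ?addr_ge0// -sqrtr_sqr; apply: ler_wsqrtr.
have := ler_norm x; have := sqr_ge0 `|x|; have := normr_ge0 x.
rewrite !expr2; nra.
Qed.

(** A power of logarithmic growth is again dominated by every positive power:
    the eigenvalue bound is applied with exponent eps / (i + 1). *)
Lemma freq_sum_growth (i : nat) (eps : R) : (0 < n)%N -> 0 < delta -> 0 < eps ->
  exists2 C, 0 <= C & forall k,
    (1 + freq_sum k) ^+ i <= C * (1 + sqnorm (freq R k)) `^ eps.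
Proof.
move=> n0 d0 e0; pose eta := eps / i.+1%:R.
have eta0 : 0 < eta by rewrite divr_gt0.
have [C1 C10 H1] := @lambda1_bound R n delta mu lam eta n0 d0 eta0.
have [C2 C20 H2] := @lambda2_bound R n delta mu eta d0 eta0.
exists ((3 + C1 + C2) ^+ i); first by rewrite exprn_ge0// !addr_ge0.
move=> k; set X := 1 + sqnorm _.
have X1 : 1 <= X by rewrite lerDl sqnorm_ge0.
have Xe : 1 <= X `^ eta.
  by have := ler_powR X1 (ltW eta0); rewrite powRr0.
apply: le_trans (_ : ((3 + C1 + C2) * X `^ eta) ^+ i <= _).
  rewrite lerXn2r ?nnegrE ?mulr_ge0 ?addr_ge0 ?sqrtr_ge0 ?powR_ge0//.
  have := sqrt_le1D (- lambda1 delta n%:R mu lam (freq R k)).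
  have := sqrt_le1D (- lambda2 delta n%:R mu (freq R k)).
  rewrite !normrN /freq_sum.
  have := H1 (freq R k); have := H2 (freq R k); rewrite -/X; lra.
rewrite exprMn ler_wpM2l ?exprn_ge0 ?addr_ge0// -powR_mulrn ?powR_ge0//.
rewrite -powRrM ler_powR// /eta mulrAC ler_pdivrMr//.
by rewrite ler_pM2l// ler_nat.
Qed.

(** The first term of Young's inequality with W = (1 + |k|^2)^s sums to the
    Sobolev norm, the second to a convergent lattice sum. *)
Lemma sobolev_majorant (s : R) (f : periodic_distribution R n) (i : nat) :
  (0 < n)%N -> 0 < delta -> n%:R < s -> sobolev s f ->
  exists B, forall (T : finType) (kappa : T -> 'cV[int]_n), injective kappa ->
    \sum_(l : T) (1 + freq_sum (kappa l)) ^+ i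
      * norm1 (fourier_coef f (kappa l)) <= B.
Proof.
move=> n0 d0 ns fs.
(* The square of X^eps times X^(- s) is then exactly X^(- n). *)
pose eps := (s - n%:R) / 2; have e0 : 0 < eps by rewrite divr_gt0// subr_gt0.
have [C C0 HC] := freq_sum_growth i n0 d0 e0.
pose w k := (1 + sqnorm (freq R k)) `^ s * csqnorm (fourier_coef f k).
exists (fine (\esum_(k in [set: 'cV[int]_n]) (w k)%:E)
  + n%:R * C ^+ 2 * 8 ^+ n) => T kappa inj.
have w0 k : 0 <= w k.
  by rewrite mulr_ge0 ?powR_ge0// sumr_ge0// => j _; rewrite sqr_ge0.
apply: le_trans (lerD (esum_fin_le inj fs w0)
  (ler_wpM2l _ (lattice_sum_le R inj))); last by rewrite mulr_ge0 ?sqr_ge0.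
rewrite mulr_sumr -big_split/=; apply: ler_sum => l _; move: (kappa l) => k.
set X := 1 + sqnorm (freq R k).
have X0 : 0 < X by rewrite ltr_wpDr ?sqnorm_ge0.
apply: le_trans (norm1_weighted _ _ (powR_gt0 s X0)) _.
rewrite lerD2l -[leRHS]mulrA ler_wpM2l// ler_pdivrMr ?powR_gt0//.
apply: le_trans (_ : C ^+ 2 * (X ^+ n)^-1 * X `^ s <= _); last first.
  rewrite ler_wpM2r ?powR_ge0// ler_wpM2l ?sqr_ge0//.
  exact: exp_sqnorm_inv_le.
apply: le_trans (_ : (C * X `^ eps) ^+ 2 <= _).
  apply: lerXn2r; rewrite ?nnegrE; last exact: HC.
    by rewrite exprn_ge0// !addr_ge0 ?sqrtr_ge0.
  by rewrite mulr_ge0 ?powR_ge0.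
rewrite exprMn -[leRHS]mulrA ler_wpM2l ?sqr_ge0//.
rewrite -(powR_mulrn 2 (powR_ge0 X eps)) -powRrM -(powR_mulrn n (ltW X0)).
rewrite -powRN -powRD; last by rewrite (gt_eqF X0) implybT.
by rewrite /eps divfK// addrC.
Qed.

End Majorant.

(** * The solution *)
Section Solution.
Local Open Scope complex_scope.
Variables (R : realType) (n : nat).

Lemma eigen_mx_mul (v : 'cV[R]_n) (p q p' q' : R) : v != 0 ->
  eigen_mx v p q *m eigen_mx v p' q' = eigen_mx v (p * p') (q * q').
Proof.
move=> v0; apply: eigen_mxP => // [|w vw].
  by rewrite -mulmxA eigen_mx_line// -scalemxAr eigen_mx_line// scalerA mulrC.
by rewrite -mulmxA !(eigen_mx_orth _ _ vw, =^~ scalemxAr) scalerA mulrC.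
Qed.

Lemma eigen_mx1 (v : 'cV[R]_n) : v != 0 -> eigen_mx v 1 1 = 1%:M.
Proof.
move=> v0; apply/esym/eigen_mxP => // [|w _]; by rewrite mul1mx scale1r.
Qed.

Lemma eigen_mx_inv (v : 'cV[R]_n) (p q : R) : v != 0 -> p != 0 -> q != 0 ->
  invmx (eigen_mx v p q) = eigen_mx v p^-1 q^-1.
Proof.
move=> v0 p0 q0.
have E : eigen_mx v p q *m eigen_mx v p^-1 q^-1 = 1%:M.
  by rewrite eigen_mx_mul// !divff// eigen_mx1.
have [U _] := mulmx1_unit E.
by rewrite -[LHS]mulmx1 -E mulKmx.
Qed.

Lemma freq_neq0 (k : 'cV[int]_n) : k != 0 -> freq R k != 0.
Proof.
apply: contra => /eqP/matrixP E; apply/eqP/matrixP => i j.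
by have := E i j; rewrite !mxE => /eqP; rewrite intr_eq0 => /eqP.
Qed.

Lemma derivative_withinD (D : set R) (u v : R -> Cvec R n) t du dv :
  derivative_within D u t du -> derivative_within D v t dv ->
  derivative_within D (fun t => u t + v t) t (du + dv).
Proof.
move=> hu hv; rewrite /derivative_within.
have -> : (fun h => (h^-1)%:C *: (u (t + h) + v (t + h) - (u t + v t))) =
  (fun h => (h^-1)%:C *: (u (t + h) - u t)) \+
  (fun h => (h^-1)%:C *: (v (t + h) - v t)).
  by apply/funext => h; rewrite /= -scalerDr opprD addrACA.
exact: (cvgD hu hv).
Qed.

Lemma derivative_within_affine (D : set R) (v : R -> Cvec R n) (t : R)
    (d : Cvec R n) :
  (forall h, v (t + h) - v t = h%:C *: d) -> derivative_within D v t d.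
Proof.
move=> vd; rewrite /derivative_within.
have cd : (fun=> d) @ within [set h | D (t + h)] 0^' --> d by exact: cvg_cst.
apply: cvg_trans cd; apply: near_eq_cvg; rewrite near_withinE; near=> h => _.
rewrite vd scalerA -rmorphM/= mulVf ?scale1r//.
near: h; exact: nbhs_dnbhs_neq.
Unshelve. all: by end_near. Qed.

Lemma sol_term_mode (delta mu lam : R) (f g : periodic_distribution R n)
    (x : 'cV[R]_n) (t : R) (k : {k : 'cV[int]_n | k != 0}) :
  let v := freq R (val k) in
  lambda1 delta n%:R mu lam v < 0 -> lambda2 delta n%:R mu v < 0 ->
  sol_term delta n%:R mu lam f g x t k =
  mode v (Num.sqrt (- lambda1 delta n%:R mu lam v))
    (Num.sqrt (- lambda2 delta n%:R mu v)) (dot v x)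
    (fourier_coef f (val k)) (fourier_coef g (val k)) 0 t.
Proof.
move=> v l1 l2; have v0 : v != 0 by apply: freq_neq0; exact: (valP k).
rewrite /sol_term /mode /cos_sqrtN_mx /sin_sqrtN_mx /sqrtN_mx /multiplier_fun.
rewrite -/v.
have := l1; rewrite -oppr_gt0 -sqrtr_gt0; move: (Num.sqrt _) => a1 a10.
have := l2; rewrite -oppr_gt0 -sqrtr_gt0; move: (Num.sqrt _) => a2 a20.
have inv := eigen_mx_inv v0 (lt0r_neq0 a10) (lt0r_neq0 a20).
rewrite inv (eigen_mx_mul _ _ _ _ v0).
have c0 a : osc 0 a 0 t = cos (a * t) by rewrite /osc expr0 mul0r !addr0 mul1r.
have s0 a : osc (- (pi / 2)) a 0 t = sin (a * t).
  by rewrite /osc expr0 mul0r add0r cosD cosN sinN cos_pihalf sin_pihalf; ring.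
by rewrite !c0 !s0.
Qed.

End Solution.

Theorem theorem23 (R : realType) (n : nat) (delta beta mu lam s1 s2 : R)
    (f g : periodic_distribution R n) :
  (1 <= n)%N -> 0 < delta -> beta = n%:R ->
  0 < mu ->
  (forall nu : 'cV[R]_n, nu != 0 -> lambda1 delta beta mu lam nu < 0) ->
  (forall nu : 'cV[R]_n, nu != 0 -> lambda2 delta beta mu nu < 0) ->
  n%:R < s1 -> n%:R < s2 ->
  sobolev s1 f -> sobolev s2 g ->
  forall x : 'cV[R]_n, torus x ->
    (forall t : R, 0 <= t ->
       sums_converge (sol_term delta beta mu lam f g x t)) /\
    smooth_curve_on [set t : R | 0 <= t] (solution delta beta mu lam f g x).
Proof.
move=> n0 d0 -> mu0 l1 l2 ns1 ns2 fs gs x _.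
pose I : choiceType := {k : 'cV[int]_n | k != 0}.
pose v (k : I) := freq R (val k).
have v0 k : v k != 0 by apply: freq_neq0; exact: (valP k).
pose a1 k := Num.sqrt (- lambda1 delta n%:R mu lam (v k)).
pose a2 k := Num.sqrt (- lambda2 delta n%:R mu (v k)).
have a10 k : 0 < a1 k by rewrite sqrtr_gt0 oppr_gt0 l1.
have a20 k : 0 < a2 k by rewrite sqrtr_gt0 oppr_gt0 l2.
pose fk (k : I) := fourier_coef f (val k).
pose gk (k : I) := fourier_coef g (val k).
pose a i t (k : I) := mode (v k) (a1 k) (a2 k) (dot (v k) x) (fk k) (gk k) i t.
pose m i (k : I) :=
  (1 + (a1 k + a2 k)) ^+ i * (12 * n%:R * (norm1 (fk k) + norm1 (gk k))).
have m_le i : exists b, forall A, partial_sum (m i) A <= b.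
  have [Bf Hf] := sobolev_majorant mu lam i n0 d0 ns1 fs.
  have [Bg Hg] := sobolev_majorant mu lam i n0 d0 ns2 gs.
  exists (12 * n%:R * (Bf + Bg)) => A.
  pose kappa (l : A) : 'cV[int]_n := val (val l).
  have inj : injective kappa by move=> p q /val_inj/val_inj.
  apply: le_trans (ler_wpM2l _ (lerD (Hf _ _ inj) (Hg _ _ inj))); last by [].
  rewrite -big_split/= mulr_sumr; apply: ler_sum => l _.
  by rewrite /m -mulrDr mulrCA.
have [B mB] := choice m_le.
have E t k : sol_term delta n%:R mu lam f g x t k = a 0%N t k.
  by apply: sol_term_mode; [exact: (l1 _ (v0 k))|exact: (l2 _ (v0 k))].
have a_le i t k : 0 <= t -> norm1 (a i t k) <= (1 + t) * m i k.
  by move=> t0; exact: mode_le.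
have a_taylor i t h k : norm1 (a i (t + h) k - a i t k - (h%:C)%C *: a i.+1 t k)
    <= h ^+ 2 * m i.+2 k by exact: mode_taylor.
have Es t : sol_term delta n%:R mu lam f g x t = a 0%N t.
  by apply/funext => k; exact: E.
clearbody a m; have key := termwise_derivative mB a_le a_taylor.
split=> [t t0|]; first by rewrite Es; exact: (key 0%N t t0).1.
(* The zero mode is affine in t; its derivatives are added by hand. *)
pose p i t : Cvec R n := match i with
  | 0%N => fourier_coef f 0 + (t%:C)%C *: fourier_coef g 0
  | 1%N => fourier_coef g 0
  | _ => 0 end.
exists (fun i t => p i t + sum (a i t)); split=> [t _|i t t0].
  by rewrite /solution Es.
apply: derivative_withinD; last exact: (key i t t0).2.
apply: derivative_within_affine => h; case: i => [|[|i]] /=.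
- by rewrite opprD addrACA subrr add0r rmorphD scalerDl addrAC subrr add0r.
- by rewrite subrr scaler0.
- by rewrite subrr scaler0.
Qed.
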